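(* There exist closed smooth manifolds $M$ and $N$ such that $$\operatorname{rank}(M\times N) > \operatorname{rank}(M)+\operatorname{rank}(N).$$
   Context: The rank of a smooth manifold $M$, denoted $\operatorname{rank}(M)$, is the maximal number $k$ of (smooth) vector fields $X_1,\dots,X_k$ on $M$ that commute pairwise (i.e. $[X_i,X_j]=0$ for all $i,j$) and are linearly independent at each point of $M$. A closed manifold is a compact manifold without boundary. *)

(* Defs.v *)
From HB Require Import structures.
From mathcomp Require Import all_boot all_order all_algebra.
From mathcomp Require Import all_classical all_reals all_analysis.
Set Implicit Arguments.
Unset Strict Implicit.
Unset Printing Implicit Defensive.
Import Order.TTheory GRing.Theory Num.Theory.
Import numFieldNormedType.Exports.
Local Open Scope classical_set_scope.
Local Open Scope ring_scope.

Section Smooth.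
Context {R : realType}.

(* U is meant to be open: then neither the continuity nor the partial
   derivatives of f at a point of U depend on the values of f outside U. *)
Fixpoint class_C (k : nat) (n : nat) (W : normedModType R)
    (U : set 'rV[R]_n) (f : 'rV[R]_n -> W) : Prop :=
  (forall x, U x -> {for x, continuous f}) /\
  if k is k'.+1 then
    forall i : 'I_n,
      (forall x, U x -> derivable f x 'e_i) /\
      class_C k' U (fun x => 'D_'e_i f x)
  else True.

Definition smooth_on (n : nat) (W : normedModType R)
    (U : set 'rV[R]_n) (f : 'rV[R]_n -> W) : Prop :=
  forall k, class_C k U f.

(* chart_map is only relevant on chart_dom, and chart_inv on chart_cod. *)
Record chart (T : topologicalType) (n : nat) := Chart {
  chart_dom : set T;
  chart_map : T -> 'rV[R]_n;
  chart_inv : 'rV[R]_n -> T }.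

Definition chart_cod (T : topologicalType) (n : nat) (c : chart T n) :
    set 'rV[R]_n :=
  chart_map c @` chart_dom c.

Definition is_chart (T : topologicalType) (n : nat) (c : chart T n) : Prop :=
  [/\ open (chart_dom c), open (chart_cod c),
      forall p, chart_dom c p -> chart_inv c (chart_map c p) = p,
      forall p, chart_dom c p -> {for p, continuous (chart_map c)} &
      forall x, chart_cod c x -> {for x, continuous (chart_inv c)}].

Definition transition_smooth (T : topologicalType) (n : nat)
    (c d : chart T n) : Prop :=
  smooth_on (chart_map c @` (chart_dom c `&` chart_dom d))
            (chart_map d \o chart_inv c).

(* A space with a set of n-dimensional charts; the manifold axioms are
   stated in [smooth_manifold].  The atlas need not be maximal. *)
Record atlas_space (n : nat) := AtlasSpace {
  carrier :> topologicalType;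
  atlas : set (chart carrier n) }.
Arguments atlas {n} M : rename.

Definition smooth_manifold (n : nat) (M : atlas_space n) : Prop :=
  [/\ hausdorff_space M, @second_countable M,
      forall c, atlas M c -> is_chart c,
      forall p : M, exists2 c, atlas M c & chart_dom c p &
      forall c d, atlas M c -> atlas M d -> transition_smooth c d].

Definition closed_manifold (n : nat) (M : atlas_space n) : Prop :=
  smooth_manifold M /\ compact [set: M].

Definition prod_chart (S T : topologicalType) (m n : nat)
    (c : chart S m) (d : chart T n) : chart (S * T)%type (m + n) :=
  Chart (chart_dom c `*` chart_dom d)
        (fun p => row_mx (chart_map c p.1) (chart_map d p.2))
        (fun v => (chart_inv c (lsubmx v), chart_inv d (rsubmx v))).

Definition prod_manifold (m n : nat) (M : atlas_space m) (N : atlas_space n) :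
    atlas_space (m + n) :=
  @AtlasSpace (m + n) (M * N)%type
    [set e | exists c d, [/\ atlas M c, atlas N d & e = prod_chart c d]].

Definition smooth_fun (n : nat) (M : atlas_space n) (f : M -> R) : Prop :=
  forall c, atlas M c -> smooth_on (chart_cod c) (f \o chart_inv c).

(* Tangent vectors at p are derivations at p of the algebra of smooth
   functions; the values of v on non-smooth functions are irrelevant. *)
Definition tangent_vector (n : nat) (M : atlas_space n) (p : M)
    (v : (M -> R) -> R) : Prop :=
  (forall (a : R) (f g : M -> R), smooth_fun f -> smooth_fun g ->
     v (fun q => a * f q + g q) = a * v f + v g) /\
  (forall f g : M -> R, smooth_fun f -> smooth_fun g ->
     v (fun q => f q * g q) = f p * v g + g p * v f).

(* [X f p] is the value on f of the tangent vector X_p; X is smooth when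
   [X f] is smooth for every smooth f. *)
Definition vector_field (n : nat) (M : atlas_space n)
    (X : (M -> R) -> M -> R) : Prop :=
  (forall p, tangent_vector p (fun f => X f p)) /\
  (forall f, smooth_fun f -> smooth_fun (X f)).

Definition lie_bracket (n : nat) (M : atlas_space n)
    (X Y : (M -> R) -> M -> R) : (M -> R) -> M -> R :=
  fun f p => X (Y f) p - Y (X f) p.

Definition fields_commute (n : nat) (M : atlas_space n)
    (X Y : (M -> R) -> M -> R) : Prop :=
  forall f, smooth_fun f -> forall p, lie_bracket X Y f p = 0.

Definition independent_at (n : nat) (M : atlas_space n) (p : M) (k : nat)
    (X : 'I_k -> (M -> R) -> M -> R) : Prop :=
  forall a : 'I_k -> R,
    (forall f, smooth_fun f -> \sum_(i < k) a i * X i f p = 0) ->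
    forall i, a i = 0.

Definition has_commuting_fields (n : nat) (M : atlas_space n) (k : nat) :
    Prop :=
  exists X : 'I_k -> (M -> R) -> M -> R,
    [/\ forall i, vector_field (X i),
        forall i j, fields_commute (X i) (X j) &
        forall p, independent_at p X].

(* A predicate rather than a function: the empty manifold, on which every
   family of fields is vacuously independent, has no rank. *)
Definition is_rank (n : nat) (M : atlas_space n) (r : nat) : Prop :=
  has_commuting_fields M r /\
  forall k, has_commuting_fields M k -> (k <= r)%N.

End Smooth.

Arguments atlas {R n} M : rename.
Arguments chart R T n : clear implicits.
Arguments atlas_space R n : clear implicits.

(* Main.v *)
From HB Require Import structures.
From mathcomp Require Import all_boot all_order all_algebra.
From mathcomp Require Import zify ring lra.
From mathcomp Require Import all_classical all_reals all_analysis.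
Require Import Defs.
Set Implicit Arguments.
Unset Strict Implicit.
Unset Printing Implicit Defensive.
Import Order.TTheory GRing.Theory Num.Theory.
Import numFieldNormedType.Exports.
Local Open Scope classical_set_scope.
Local Open Scope ring_scope.

(* Let [L] be an integral matrix of order [N] acting on a torus, and [M_L] its
   mapping torus: a flat manifold, the quotient of [R^n] by a group of affine
   maps.  Take [N] and [N'] coprime, 3-dimensional [M_L] and [M_L'] with
   [N = 3] and [N' = 2], and let [s], [t] be the base coordinates.

   Upper bound: [n] commuting independent fields on an [n]-manifold [M_L] have
   closed dual 1-forms, which are differentials [dF_l] on [R^n].  Each [F_l] is
   invariant under the deck group up to constants, and these constants vanish
   on the translations of the fibre since [1] is not an eigenvalue of [L] there.
   Hence some nontrivial combination of the [F_l] descends to the compact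
   manifold [M_L]; it has a maximum, where its differential vanishes, which
   contradicts the independence of the [dF_l].  So both ranks are at most 2.

   Lower bound: let [theta = N' s - N t].  Since [N] and [N'] are coprime, there
   is a rotation of each fibre depending only on [theta] that undergoes both
   monodromies.  Rotating the constant fields in the kernel of [theta] gives
   invariant fields on the product; they commute, as [theta] is constant along
   them.  So the rank of the product is at least 5. *)

(** * Smooth real functions *)

(** The combination in the upper bound exists for a counting reason: once the periods along the
    fibre are gone, each [F_l] keeps a single constant, the one of the monodromy, so two of the
    [F_l] already have a combination without periods. The shape of [theta] comes from the two
    monodromies. A turn of [s] changes [theta] by [N'] and a turn of [t] changes it by [- N]. A
    rotation of the first fibre whose [N]-th power is trivial ignores the second change, and a
    multiple of [theta] that is 1 modulo [N] after a turn of [s] exists because [N'] is invertible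
    modulo [N]; symmetrically for the second fibre. The fibres have dimension 2 because in dimension
    1 the only monodromy without eigenvalue 1 is [-1], which lies in no one-parameter group. The
    main technical obstacle is that vector fields are given as derivations on global smooth
    functions. Bump functions and Hadamard's lemma turn them into smooth equivariant maps on [R^n],
    and every later argument takes place there. *)

Section ClassC.
Context {R : realType}.

Lemma funD_continuous (T : topologicalType) (f g : T -> R) :
  continuous f -> continuous g -> continuous (fun x => f x + g x).
Proof. by move=> cf cg x; exact: (continuousD (cf x) (cg x)). Qed.
Lemma funB_continuous (T : topologicalType) (f g : T -> R) :
  continuous f -> continuous g -> continuous (fun x => f x - g x).
Proof. by move=> cf cg x; exact: (continuousB (cf x) (cg x)). Qed.
Lemma funM_continuous (T : topologicalType) (f g : T -> R) :
  continuous f -> continuous g -> continuous (fun x => f x * g x).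
Proof. by move=> cf cg x; exact: (continuousM (cf x) (cg x)). Qed.

Lemma funsum_continuous (T : topologicalType) n (f : 'I_n -> T -> R) :
  (forall i, continuous (f i)) -> continuous (fun x => \sum_i f i x).
Proof.
move=> cf; elim: (index_enum _) => [|i r IH].
  by under eq_fun do rewrite big_nil; exact: cst_continuous.
by under eq_fun do rewrite big_cons; apply: funD_continuous => //; exact: cf.
Qed.

Lemma class_CW n (W : normedModType R) k (U : set 'rV[R]_n) (f : 'rV[R]_n -> W) :
  class_C k.+1 U f -> class_C k U f.
Proof.
elim: k f => [|k IH] f [cf df]; split => // i.
by split; [exact: (df i).1 | apply: IH; exact: (df i).2].
Qed.

Lemma eq_class_C n (W : normedModType R) k (U : set 'rV[R]_n)
    (f g : 'rV[R]_n -> W) : g =1 f -> class_C k U f -> class_C k U g.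
Proof. by move=> /funext ->. Qed.

(** Continuity, derivability and the partial derivatives at [x] depend only on the germ of [f]
    there, so the induction keeps the neighbourhood [V] and passes from [g] to its partial
    derivatives. *)
Lemma class_C_local n (W : normedModType R) k (U : set 'rV[R]_n)
    (f : 'rV[R]_n -> W) :
  (forall x, U x -> exists V g, [/\ open V, V x, class_C k V g &
     {in V, f =1 g}]) -> class_C k U f.
Proof.
elim: k U f => [|k IH] U f H.
  split => // x Ux; have [V [g [oV Vx [cg _] fg]]] := H x Ux.
  have E : \near x, g x = f x.
    by near=> y; rewrite fg// inE; near: y; exact: open_nbhs_nbhs.
  change (f @ x --> f x); rewrite -(nbhs_singleton E).
  have cgx : g @ x --> g x := cg x Vx.
  by apply: cvg_trans cgx; exact: near_eq_cvg E.
split => [x Ux|i].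
  have [V [g [oV Vx [cg _] fg]]] := H x Ux.
  have E : \near x, g x = f x.
    by near=> y; rewrite fg// inE; near: y; exact: open_nbhs_nbhs.
  change (f @ x --> f x); rewrite -(nbhs_singleton E).
  have cgx : g @ x --> g x := cg x Vx.
  by apply: cvg_trans cgx; exact: near_eq_cvg E.
split=> [x Ux|].
  have [V [g [oV Vx [cg dg] fg]]] := H x Ux.
  apply: (near_eq_derivable _ ((dg i).1 x Vx)).
  by near=> y; rewrite fg// inE; near: y; exact: open_nbhs_nbhs.
apply: IH => x Ux; have [V [g [oV Vx [cg dg] fg]]] := H x Ux.
exists V, (fun x => 'D_'e_i g x); split => //; first exact: (dg i).2.
move=> y /set_mem Vy; apply: near_eq_derive.
by near=> z; rewrite fg// inE; near: z; exact: open_nbhs_nbhs.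
Unshelve. all: by end_near. Qed.

Lemma class_CT n (W : normedModType R) k (U : set 'rV[R]_n) (f : 'rV[R]_n -> W) :
  class_C k setT f -> class_C k U f.
Proof.
move=> Cf; apply: class_C_local => x _; exists setT, f; split => //.
exact: openT.
Qed.

Lemma class_C_cst n (W : normedModType R) k (w : W) :
  class_C k setT (fun _ : 'rV[R]_n => w).
Proof.
elim: k w => [|k IH] w; (split; first by move=> x _; exact: cst_continuous) => // i.
 split => [x _|]; first exact: (derivable_cst w x 'e_i).
apply: (@eq_class_C _ _ _ _ (fun=> 0)) => [x|]; last exact: IH.
by rewrite derive_cst.
Qed.

Lemma class_CD n k (f g : 'rV[R]_n -> R) : class_C k setT f ->
  class_C k setT g -> class_C k setT (fun x => f x + g x).
Proof.
elim: k f g => [|k IH] f g [cf df] [cg dg]; split => //.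
- by move=> x _; apply: continuousD; [exact: (cf x I)|exact: (cg x I)].
- by move=> x _; apply: continuousD; [exact: (cf x I)|exact: (cg x I)].
move=> i; split => [x _|].
  by apply: derivableD; [exact: ((df i).1 x I)|exact: ((dg i).1 x I)].
apply: (@eq_class_C _ _ _ _ (fun x => 'D_'e_i f x + 'D_'e_i g x)) => [x|].
  rewrite -deriveD//; [exact: ((df i).1 x I)|exact: ((dg i).1 x I)].
by apply: IH; [exact: (df i).2|exact: (dg i).2].
Qed.

Lemma class_CM n k (f g : 'rV[R]_n -> R) : class_C k setT f ->
  class_C k setT g -> class_C k setT (fun x => f x * g x).
Proof.
elim: k f g => [|k IH] f g Cf Cg.
  by split => // x _; apply: continuousM; [exact: (Cf.1 x I)|exact: (Cg.1 x I)].
split => [x _|i]; first by apply: continuousM; [exact: (Cf.1 x I)|exact: (Cg.1 x I)].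
have [Cf' Cg'] := (class_CW Cf, class_CW Cg).
case: Cf Cg => cf df [cg dg]; split => [x _|].
  by apply: derivableM; [exact: ((df i).1 x I)|exact: ((dg i).1 x I)].
apply: (@eq_class_C _ _ _ _ 
  (fun x => f x * 'D_'e_i g x + g x * 'D_'e_i f x)) => [x|].
  rewrite -[LHS]/('D_('e_i) (f * g) x) deriveM//.
    exact: ((df i).1 x I).
  exact: ((dg i).1 x I).
by apply: class_CD; apply: IH => //; [exact: (dg i).2|exact: (df i).2].
Qed.

Lemma class_CN n k (f : 'rV[R]_n -> R) : class_C k setT f ->
  class_C k setT (fun x => - f x).
Proof.
move=> Cf; apply: (@eq_class_C _ _ _ _ (fun x => - 1 * f x)) => [x|].
  by rewrite mulN1r.
by apply: class_CM => //; exact: class_C_cst.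
Qed.

Lemma class_CB n k (f g : 'rV[R]_n -> R) : class_C k setT f ->
  class_C k setT g -> class_C k setT (fun x => f x - g x).
Proof. by move=> Cf Cg; apply: class_CD => //; exact: class_CN. Qed.

Lemma class_C_sum n k (I : Type) (r : seq I) (P : pred I)
    (f : I -> 'rV[R]_n -> R) : (forall i, P i -> class_C k setT (f i)) ->
  class_C k setT (fun x => \sum_(i <- r | P i) f i x).
Proof.
move=> H; elim: r => [|i r IH].
  by under eq_fun do rewrite big_nil; exact: class_C_cst.
under eq_fun do rewrite big_cons; have := H i; case: (P i) => // /(_ isT) Hi.
exact: class_CD.
Qed.

Lemma class_C_prod n k (I : Type) (r : seq I) (P : pred I)
    (f : I -> 'rV[R]_n -> R) : (forall i, P i -> class_C k setT (f i)) ->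
  class_C k setT (fun x => \prod_(i <- r | P i) f i x).
Proof.
move=> H; elim: r => [|i r IH].
  by under eq_fun do rewrite big_nil; exact: class_C_cst.
under eq_fun do rewrite big_cons; have := H i; case: (P i) => // /(_ isT) Hi.
exact: class_CM.
Qed.

Lemma class_CV n k (f : 'rV[R]_n -> R) : (forall x, f x != 0) ->
  class_C k setT f -> class_C k setT (fun x => (f x)^-1).
Proof.
move=> f0; elim: k => [|k IH] Cf.
  by split => // x _; apply: continuousV => //; exact: (Cf.1 x I).
split => [x _|i]; first by apply: continuousV => //; exact: (Cf.1 x I).
have IH' := IH (class_CW Cf).
split => [x _|]; first by apply: derivableV => //; exact: ((Cf.2 i).1 x I).
apply: (@eq_class_C _ _ _ _ 
  (fun x => - ((f x)^-1 * (f x)^-1 * 'D_'e_i f x))) => [x|].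
  rewrite deriveV//; last exact: ((Cf.2 i).1 x I).
  by rewrite expr2 invfM scaleNr.
apply: class_CN; apply: class_CM; last exact: (Cf.2 i).2.
exact: class_CM.
Qed.

Lemma is_derive_coord n (j : 'I_n) (x w : 'rV[R]_n) :
  is_derive x w (fun y => y ord0 j) (w ord0 j).
Proof.
have Did : derivable (id : 'rV[R]_n -> 'rV[R]_n) x w by exact: derivable_id.
apply: DeriveDef; first exact: (derivable_mxP _ _ _).1 Did ord0 j.
by have := derive_mx Did; rewrite derive_id => {2}->; rewrite mxE.
Qed.

Lemma class_C_coord n k (j : 'I_n) :
  class_C k setT (fun x : 'rV[R]_n => x ord0 j).
Proof.
case: k => [|k]; (split; first by move=> x _; exact: coord_continuous) => // i.
split=> [x _|]; first by have [] := is_derive_coord j x 'e_i.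
apply: (@eq_class_C _ _ _ _ (fun=> ('e_i : 'rV[R]_n) ord0 j)) => [x|]; last exact: class_C_cst.
by have /@derive_val -> := is_derive_coord j x 'e_i.
Qed.

Lemma derive_line (V W : normedModType R) (f : V -> W) (x v : V) :
  'D_v f x = (fun h : R => f (h *: v + x))^`()%classic 0.
Proof.
rewrite /derive /derive1.
set g1 := fun h => h^-1 *: _; set g2 := fun h => h^-1 *: _.
suff -> : g1 = g2 by [].
by apply/funext => h; rewrite /g1 /g2 /= addr0 scale0r add0r.
Qed.

(* [d] makes the family [s] closed under derivation, so that the induction on
   [k] treats all its members at once. *)
Lemma class_C_comp1 n k (J : Type) (s : J -> R -> R) (d : J -> J)
    (ds : forall i (t : R), is_derive t 1 (s i) (s (d i) t)) (i : J)
    (q : 'rV[R]_n -> R) :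
  class_C k setT q -> class_C k setT (fun x => s i (q x)).
Proof.
have cs j : continuous (s j).
  move=> t; apply: differentiable_continuous; apply/derivable1_diffP.
  by have [] := ds j t.
elim: k i q => [|k IH] i q Cq.
  by split => // x _; exact: (continuous_comp (Cq.1 x I) (cs i _)).
split => [x _|j]; first exact: (continuous_comp (Cq.1 x I) (cs i _)).
have H x : is_derive x 'e_j (fun x => s i (q x)) (s (d i) (q x) * 'D_'e_j q x).
  have := (Cq.2 j).1 x I; set l := fun h : R => q (h *: 'e_j + x).
  move=> /derivable1P dl.
  have e : l 0 = q x by rewrite /l scale0r add0r.
  have dsl : derivable (s i) (l 0) 1 by have [] := ds i (l 0).
  apply: DeriveDef.
    apply/derivable1P; apply/derivable1_diffP.
    apply: (@differentiable_comp _ _ _ _ l (s i)); exact/derivable1_diffP.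
  rewrite derive_line (derive1_comp dl dsl) -derive_line -e derive1E.
  by have /@derive_val -> := ds i (l 0).
split => [x _|]; first by have [] := H x.
apply: (@eq_class_C _ _ _ _ (fun x => s (d i) (q x) * 'D_'e_j q x)) => [x|].
  by have /@derive_val -> := H x.
by apply: class_CM; [apply: IH; exact: class_CW|exact: (Cq.2 j).2].
Qed.

End ClassC.

(** * Directional derivatives and affine changes of variables *)

Section Directional.
Context {R : realType}.

Lemma is_deriveP (V W : normedModType R) (f : V -> W) x v df :
  is_derive x v f df <->
  (fun h : R => h^-1 *: (f (h *: v + x) - f x)) @ 0^' --> df.
Proof.
split=> [[/cvg_ex[l fl] <-]|fl].
  by rewrite /derive (cvg_lim _ fl).
by apply: DeriveDef; [apply/cvg_ex; exists df|exact: cvg_lim fl].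
Qed.

Lemma is_derive_line (V W : normedModType R) (f : V -> W) x v (t : R) df :
  is_derive (t *: v + x) v f df ->
  is_derive t 1 (fun h : R => f (h *: v + x)) df.
Proof.
move=> /is_deriveP H; apply/is_deriveP; apply: cvg_trans H.
apply: near_eq_cvg; apply: nearW => h.
by rewrite scaler1 scalerDl addrA.
Qed.

(** The bound [|c| <= |s|] replaces the usual interval so that both signs of [s] are covered; it is
    all that the limit arguments need. *)
Lemma MVT_line (V : normedModType R) (f : V -> R) v y (s : R) :
  (forall z, derivable f z v) ->
  exists2 c : R, `|c| <= `|s| &
    f (s *: v + y) - f y = s * 'D_v f (c *: v + y).
Proof.
move=> df; pose g h : R := f (h *: v + y).
have dg (t : R) : is_derive t 1 g ('D_v f (t *: v + y)).
  by apply: is_derive_line; exact: derivableP.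
have cg (A : set R) : {within A, continuous g}.
  apply: continuous_subspaceT => t; apply: differentiable_continuous.
  by apply/derivable1_diffP; have [] := dg t.
have g0 : g 0 = f y by rewrite /g scale0r add0r.
have [s0|/ltW s0] := leP 0 s.
  have [c] := MVT_segment s0 (fun t _ => dg t) (cg _).
  rewrite in_itv/= => /andP[c0 cs]; rewrite g0 subr0 mulrC => E.
  by exists c; [rewrite !ger0_norm|].
have [c] := MVT_segment s0 (fun t _ => dg t) (cg _).
rewrite in_itv/= => /andP[cs c0]; rewrite g0 sub0r mulrC mulNr => E.
exists c; first by rewrite !ler0_norm// lerN2.
by rewrite -[RHS]opprK -E opprB.
Qed.

(** The increment along [c *: u + w] splits into one along [w] from [x] and one along [u] from
    [h *: w + x]. The mean value theorem turns the latter into [c] times ['D_u f] at a point tending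
    to [x], where ['D_u f] is continuous. *)
Lemma is_derive_add_dir (V : normedModType R) (f : V -> R) (x u w : V)
    (c a : R) : (forall z, derivable f z u) ->
  {for x, continuous (fun z => 'D_u f z)} -> is_derive x w f a ->
  is_derive x (c *: u + w) f (c * 'D_u f x + a).
Proof.
move=> du cu /is_deriveP dw; apply/is_deriveP.
pose q h : R := h^-1 * (f ((h * c) *: u + (h *: w + x)) - f (h *: w + x)).
apply: (@cvg_trans _ (q h + h^-1 *: (f (h *: w + x) - f x) @[h --> 0^'])).
  apply: near_eq_cvg; apply: nearW => h.
  by rewrite /q -[X in _ + X]/(h^-1 * _) -mulrDr subrKA addrA -scalerA -scalerDr.
apply: cvgD => //.
apply/cvgrPdist_lt => e e0.
have e1 : 0 < e / (`|c| + 1) by rewrite divr_gt0// ltr_wpDl.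
have /cvgrPdist_lt/(_ _ e1) := cu; rewrite near_nbhs.
move=> /nbhs_ballP[d /= d0 Hd].
near=> h.
have h0 : h != 0 by near: h; exact: nbhs_dnbhs_neq.
have [r rle E] := MVT_line (h *: w + x) (h * c) du.
rewrite /q E -[h * c * _]mulrA mulKf// -mulrBr normrM.
have : `|'D_u f x - 'D_u f (r *: u + (h *: w + x))| < e / (`|c| + 1).
  apply: Hd; rewrite -ball_normE /ball_/= addrA opprD addrCA subrr addr0 normrN.
  apply: le_lt_trans (ler_normD _ _) _; rewrite !normrZ.
  apply: (@le_lt_trans _ _ (`|h| * (`|c| * `|u| + `|w|))).
    by rewrite mulrDr mulrA lerD2r ler_wpM2r// -normrM.
  have K0 : 0 < `|c| * `|u| + `|w| + 1 by rewrite ltr_wpDl// addr_ge0.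
  apply: (@le_lt_trans _ _ (`|h| * (`|c| * `|u| + `|w| + 1))).
    by rewrite ler_wpM2l// lerDl.
  rewrite -ltr_pdivlMr//.
  by near: h; apply: dnbhs0_lt; rewrite divr_gt0.
move=> /ltW/(ler_wpM2l (normr_ge0 c))/le_lt_trans; apply.
by rewrite mulrCA gtr_pMr// ltr_pdivrMr ?ltr_wpDl// mul1r ltrDl.
Unshelve. all: by end_near. Qed.

Lemma class_C_continuous n k (f : 'rV[R]_n -> R) :
  class_C k setT f -> continuous f.
Proof. by case: k => [|k] [cf _] x; exact: cf. Qed.

Lemma class_C_derivable n k (f : 'rV[R]_n -> R) i x :
  class_C k.+1 setT f -> derivable f x 'e_i.
Proof. by move=> [_ df]; exact: (df i).1. Qed.

Lemma class_C_partial n k (f : 'rV[R]_n -> R) i :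
  class_C k.+1 setT f -> class_C k setT (fun x => 'D_'e_i f x).
Proof. by move=> [_ df]; exact: (df i).2. Qed.

(** The coordinate directions of [v] are added one at a time by [is_derive_add_dir], which avoids
    Fréchet differentiability. *)
Lemma is_derive_dir n (f : 'rV[R]_n -> R) x v : class_C 1%N setT f ->
  is_derive x v f (\sum_j v ord0 j * 'D_'e_j f x).
Proof.
move=> Cf; rewrite [v in is_derive _ v]row_sum_delta.
elim: (index_enum _) => [|j r IH].
  by rewrite !big_nil; exact: is_derive0.
rewrite !big_cons; apply: is_derive_add_dir IH => [z|].
  exact (@class_C_derivable _ 0 f j z Cf).
exact: (class_C_continuous (class_C_partial j Cf) (x := x)).
Qed.

Lemma derive_dir n (f : 'rV[R]_n -> R) x v : class_C 1%N setT f ->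
  'D_v f x = \sum_j v ord0 j * 'D_'e_j f x.
Proof. by move=> Cf; have /@derive_val := is_derive_dir x v Cf. Qed.

Lemma derivable_dir n (f : 'rV[R]_n -> R) x v : class_C 1%N setT f ->
  derivable f x v.
Proof. by move=> Cf; have [] := is_derive_dir x v Cf. Qed.

Lemma gradient0_cst n (f : 'rV[R]_n -> R) x y : class_C 1%N setT f ->
  (forall z j, 'D_'e_j f z = 0) -> f x = f y.
Proof.
move=> Cf f0; have [z|c _] := @MVT_line _ f (x - y) y 1.
  exact: derivable_dir.
rewrite scale1r subrK derive_dir// big1 ?mulr0 => [/eqP|j _].
  by rewrite subr_eq0 => /eqP.
by rewrite f0 mulr0.
Qed.


Lemma coord_le_norm n (x : 'rV[R]_n) j : `|x ord0 j| <= `|x|.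
Proof.
rewrite [leRHS]/Num.Def.normr/= mx_normrE.
exact: (le_bigmax _ (fun i : 'I_1 * 'I_n => `|x i.1 i.2|) (ord0, j)).
Qed.

Lemma norm_le_coord n (x : 'rV[R]_n) M : 0 <= M ->
  (forall j, `|x ord0 j| <= M) -> `|x| <= M.
Proof.
move=> M0 H; rewrite /Num.Def.normr/= mx_normrE.
by apply: bigmax_le => // -[i j] _; rewrite ord1; exact: H.
Qed.

Lemma mulmx_bounded m n (L : 'M[R]_(m, n)) :
  exists2 K, 0 < K & forall x : 'rV_m, `|x *m L| <= K * `|x|.
Proof.
exists (1 + \sum_i \sum_j `|L i j|) => [|x].
  by rewrite ltr_pwDl// sumr_ge0// => i _; rewrite sumr_ge0.
have S0 : 0 <= \sum_i \sum_j `|L i j| by rewrite sumr_ge0// => i _; rewrite sumr_ge0.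
apply: norm_le_coord => [|j]; first by rewrite mulr_ge0// addr_ge0.
rewrite mxE; apply: (le_trans (ler_norm_sum _ _ _)).
rewrite mulrDl -[leLHS]add0r lerD ?mul1r// mulr_suml ler_sum// => i _.
rewrite normrM mulrC ler_pM ?coord_le_norm// (bigD1 j)//= lerDl.
by rewrite sumr_ge0.
Qed.

Lemma lipschitz_continuous (V W : normedModType R) (f : V -> W) K : 0 < K ->
  (forall x y, `|f x - f y| <= K * `|x - y|) -> continuous f.
Proof.
move=> K0 HK x; apply/cvgrPdist_lt => e e0; near=> y.
apply: (le_lt_trans (HK _ _)); rewrite mulrC -ltr_pdivlMr//.
by near: y; apply: cvgr_dist_lt; rewrite ?divr_gt0.
Unshelve. all: by end_near. Qed.

Lemma affine_continuous m n (L : 'M[R]_(m, n)) v :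
  continuous (fun x : 'rV[R]_m => x *m L + v).
Proof.
have [K K0 HK] := mulmx_bounded L.
apply: (lipschitz_continuous K0) => x y.
by rewrite opprD addrACA subrr addr0 -mulmxBl; exact: HK.
Qed.

Lemma is_derive_affine m n (f : 'rV[R]_n -> R) (L : 'M[R]_(m, n)) v x w df :
  is_derive (x *m L + v) (w *m L) f df ->
  is_derive x w (fun y => f (y *m L + v)) df.
Proof.
move=> /is_deriveP H; apply/is_deriveP; apply: cvg_trans H.
apply: near_eq_cvg; apply: nearW => h.
by rewrite mulmxDl -scalemxAl addrA.
Qed.

Lemma class_C_affine m n k (f : 'rV[R]_n -> R) (L : 'M[R]_(m, n)) v :
  class_C k setT f -> class_C k setT (fun x => f (x *m L + v)).
Proof.
have cL := @affine_continuous m n L v.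
have cf (g : 'rV[R]_n -> R) (x : 'rV[R]_m) : continuous g ->
    {for x, continuous (fun x : 'rV[R]_m => g (x *m L + v))}.
  by move=> cg; exact: (continuous_comp (cL x) (cg _)).
elim: k f => [|k IH] f Cf.
  by split => // x _; apply: cf; exact: class_C_continuous Cf.
split=> [x _|i]; first by apply: cf; exact: class_C_continuous Cf.
have C1 : class_C 1%N setT f.
  by elim: k Cf {IH} => // k IH /class_CW.
have H x : is_derive x 'e_i (fun y => f (y *m L + v))
    (\sum_j (('e_i : 'rV_m) *m L) ord0 j * 'D_'e_j f (x *m L + v)).
  by apply: is_derive_affine; exact: is_derive_dir.
split=> [x _|]; first by have [] := H x.
apply: (@eq_class_C _ _ _ _ _ (fun x =>
  \sum_j (('e_i : 'rV_m) *m L) ord0 j * 'D_'e_j f (x *m L + v))) => [x|].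
  by have /@derive_val := H x.
apply: class_C_sum => j _; apply: class_CM; first exact: class_C_cst.
by apply: (IH (fun y => 'D_'e_j f y)); exact: class_C_partial.
Qed.

End Directional.

(** * Symmetry of second derivatives, integrals over the unit interval *)

Section Schwarz.
Context {R : realType}.

Let double_difference n (f : 'rV[R]_n -> R) (i j : 'I_n) (x : 'rV[R]_n) (s : R) :=
  (f (s *: 'e_i + (s *: 'e_j + x)) - f (s *: 'e_j + x)) -
  (f (s *: 'e_i + x) - f x).

Let double_difference_sym n (f : 'rV[R]_n -> R) i j x s :
  double_difference f i j x s = double_difference f j i x s.
Proof.
by rewrite /double_difference addrCA; ring.
Qed.

(** Two mean value steps, first along ['e_j] for the increment of [f] by [s *: 'e_i], then along
    ['e_i] for ['D_'e_j f], write the double difference as [s ^+ 2] times a second partial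
    derivative at a point tending to [x]. Its symmetry in [i] and [j] then gives Schwarz's
    theorem. *)
Let double_difference_cvg n (f : 'rV[R]_n -> R) i j x : class_C 2%N setT f ->
  (double_difference f i j x s / s ^+ 2) @[s --> 0^'] -->
    'D_'e_i (fun y => 'D_'e_j f y) x.
Proof.
move=> Cf; set D := fun y => 'D_'e_i (fun y => 'D_'e_j f y) y.
have cD : {for x, continuous D}.
  exact: (class_C_continuous
    (@class_C_partial _ _ 0 _ i (@class_C_partial _ _ 1 f j Cf)) (x := x)).
have E s : exists a b, [/\ `|a| <= `|s|, `|b| <= `|s| &
    double_difference f i j x s = s ^+ 2 * D (a *: 'e_i + (b *: 'e_j + x))].
  pose g y := f (s *: 'e_i + y) - f y.
  have dg z : is_derive z 'e_j g ('D_'e_j f (s *: 'e_i + z) - 'D_'e_j f z).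
    apply: is_deriveB; last exact/derivableP/(@class_C_derivable _ _ 1 f).
    apply/is_deriveP.
    have /is_deriveP H := derivableP (@class_C_derivable _ _ 1 f j (s *: 'e_i + z) Cf).
    apply: cvg_trans H; apply: near_eq_cvg; apply: nearW => h.
    by rewrite addrCA.
  have [z|b bs Eb] := @MVT_line _ _ g 'e_j x s; first by have [] := dg z.
  have dj z : derivable (fun y => 'D_'e_j f y) z 'e_i.
    exact: (@class_C_derivable _ _ 0 _ i z (@class_C_partial _ _ 1 f j Cf)).
  have [a as_ Ea] := MVT_line (b *: 'e_j + x) s dj.
  exists a, b; split => //.
  rewrite -[LHS]/(g (s *: 'e_j + x) - g x) Eb.
  by have /@derive_val -> := dg (b *: 'e_j + x); rewrite Ea expr2 mulrA.
apply/cvgrPdist_lt => e e0.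
have /cvgrPdist_lt/(_ _ e0) := cD; rewrite near_nbhs => /nbhs_ballP[d /= d0 Hd].
near=> s.
have s0 : s != 0 by near: s; exact: nbhs_dnbhs_neq.
have [a [b [as_ bs ->]]] := E s.
rewrite mulrAC divff ?expf_neq0// mul1r; apply: Hd.
rewrite -ball_normE /ball_/= addrA opprD addrCA subrr addr0 normrN.
apply: le_lt_trans (ler_normD _ _) _; rewrite !normrZ.
apply: (@le_lt_trans _ _ (`|s| * (`|'e_i : 'rV[R]_n| + `|'e_j : 'rV[R]_n| + 1))).
  by rewrite mulrDr mulr1 ler_wpDr// mulrDr lerD// ler_wpM2r.
have K0 : 0 < `|'e_i : 'rV[R]_n| + `|'e_j : 'rV[R]_n| + 1.
  by rewrite ltr_wpDl// addr_ge0.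
rewrite -ltr_pdivlMr//.
by near: s; apply: dnbhs0_lt; rewrite divr_gt0.
Unshelve. all: by end_near. Qed.

Lemma partialC n (f : 'rV[R]_n -> R) i j x : class_C 2%N setT f ->
  'D_'e_i (fun y => 'D_'e_j f y) x = 'D_'e_j (fun y => 'D_'e_i f y) x.
Proof.
move=> Cf; have := double_difference_cvg (i := j) (j := i) (x := x) Cf.
under eq_fun do rewrite double_difference_sym.
move=> /(cvg_lim (@norm_hausdorff _ _)) <-.
apply/esym/(cvg_lim (@norm_hausdorff _ _)).
exact: double_difference_cvg.
Qed.

End Schwarz.

Section UnitInterval.
Context {R : realType}.
Implicit Types h H : R -> R.

Definition int01 h : R := \int[@lebesgue_measure R]_(t in `[0%R, 1%R]) h t.

Lemma int01_FTC h H : continuous h ->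
  (forall t : R, 0 <= t <= 1 -> is_derive t 1 H (h t)) -> int01 h = H 1 - H 0.
Proof.
move=> ch dH.
have cH (t : R) : 0 <= t <= 1 -> H @ t --> H t.
  move=> t01; apply: differentiable_continuous; apply/derivable1_diffP.
  by have [] := dH t t01.
rewrite /int01 /Rintegral (@continuous_FTC2 _ h H) ?ltr01//.
- exact: continuous_subspaceT.
- split.
  + move=> t; rewrite in_itv/= => /andP[t0 t1].
    by have [] := dH t; rewrite ?ltW.
  + by apply: cvg_at_right_filter; apply: cH; rewrite lexx ler01.
  + by apply: cvg_at_left_filter; apply: cH; rewrite lexx ler01.
- move=> t; rewrite in_itv/= => /andP[t0 t1].
  have t01 : 0 <= t <= 1 by rewrite !ltW.
  by rewrite derive1E; have /@derive_val := dH t t01.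
Qed.

(** With an antiderivative at hand, the properties of [int01] below reduce to the fundamental
    theorem and need no further measure theory. *)
Lemma antiderivative01 h : continuous h ->
  exists H, forall t : R, 0 <= t <= 1 -> is_derive t 1 H (h t).
Proof.
move=> ch.
(* Starting at -1, inside the larger interval from -1 to 2, makes 0 and 1 interior points, so that
   the derivative there is two-sided. *)
exists (fun x => \int[@lebesgue_measure R]_(t in `[-1, x]) h t)%R.
move=> t /andP[t0 t1].
have ih : (@lebesgue_measure R).-integrable `[-1, 2] (EFin \o h).
  apply: continuous_compact_integrable; first exact: segment_compact.
  exact: continuous_subspaceT.
have t2 : t < 2 by rewrite (le_lt_trans t1)// ltr1n.
have Nt : -1 < t by rewrite (lt_le_trans _ t0)// ltrN10.
have [d E] := continuous_FTC1_closed t2 ih Nt (ch t).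
by split; [exact: d|rewrite -derive1E; exact: E].
Qed.

Lemma int01D h g : continuous h -> continuous g ->
  int01 (fun t => h t + g t) = int01 h + int01 g.
Proof.
move=> ch cg; have [H dH] := antiderivative01 ch.
have [G dG] := antiderivative01 cg.
rewrite (int01_FTC ch dH) (int01_FTC cg dG).
transitivity ((H \+ G) 1 - (H \+ G) 0); last by rewrite /= opprD addrACA.
apply: int01_FTC.
- by move=> t; apply: continuousD; [exact: ch|exact: cg].
- by move=> t t01; apply: is_deriveD; [exact: dH|exact: dG].
Qed.

Lemma int01Z c h : continuous h ->
  int01 (fun t => c * h t) = c * int01 h.
Proof.
move=> ch; have [H dH] := antiderivative01 ch.
rewrite (int01_FTC ch dH).
transitivity ((c \*: H) 1 - (c \*: H) 0); last by rewrite /= -scalerBr.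
apply: int01_FTC.
- by move=> t; apply: continuousM; [exact: cst_continuous|exact: ch].
- by move=> t t01; apply: is_deriveZ; exact: dH.
Qed.

Lemma int01B h g : continuous h -> continuous g ->
  int01 (fun t => h t - g t) = int01 h - int01 g.
Proof.
move=> ch cg.
have -> : (fun t => h t - g t) = (fun t => h t + (-1) * g t).
  by apply/funext => t; rewrite mulN1r.
have cg' : continuous (fun t => (-1) * g t).
  by move=> t; apply: (@continuousM _ _ (fun=> -1) g t); [exact: cst_continuous|exact: cg].
by rewrite (int01D ch cg') int01Z// mulN1r.
Qed.

Lemma int01_cst c : int01 (fun=> c) = c.
Proof.
transitivity ((c \*: @id R) 1 - (c \*: @id R) 0).
  apply: int01_FTC => [|t _]; first exact: cst_continuous.
  rewrite -[X in is_derive _ _ _ X]mulr1 -[c * 1]/(c *: 1 : R).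
  exact: is_deriveZ.
by rewrite /= scaler0 subr0 /GRing.scale/= mulr1.
Qed.

Lemma int01_sum n (h : 'I_n -> R -> R) : (forall i, continuous (h i)) ->
  int01 (fun t => \sum_i h i t) = \sum_i int01 (h i).
Proof.
move=> ch; rewrite [RHS]big_mkcond; under eq_fun do rewrite big_mkcond.
suff : int01 (fun t => \sum_(i <- index_enum 'I_n) h i t) =
   \sum_(i <- index_enum 'I_n) int01 (h i) /\
   continuous (fun t => \sum_(i <- index_enum 'I_n) h i t) by case.
elim: (index_enum _) => [|i r [IH cr]].
  rewrite big_nil; under eq_fun do rewrite big_nil; rewrite int01_cst.
  by split => //; exact: cst_continuous.
rewrite big_cons; under eq_fun do rewrite big_cons.
rewrite int01D// IH; split => // t.
by apply: continuousD; [exact: ch|exact: cr].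
Qed.

Lemma int01_norm_le h C : continuous h ->
  (forall t, 0 <= t <= 1 -> `|h t| <= C) -> `|int01 h| <= C.
Proof.
move=> ch hC; have [H dH] := antiderivative01 ch.
rewrite (int01_FTC ch dH).
have [|c|c c01 ->] := @MVT_segment _ H h 0 1 ler01.
- move=> t; rewrite in_itv/= => /andP[t0 t1]; apply: dH; by rewrite !ltW.
- apply: derivable_within_continuous => t; rewrite in_itv/= => t01.
  by have [] := dH t t01.
- by rewrite subr0 mulr1; apply: hC; rewrite in_itv in c01.
Qed.

End UnitInterval.

(** * Differentiation under the integral sign; the lemmas of Hadamard and Poincaré *)

Section RayIntegral.
Context {R : realType}.

Lemma continuous_bounded_ball n (f : 'rV[R]_n -> R) M : continuous f ->
  exists2 C, 0 <= C & forall y, `|y| <= M -> `|f y| <= C.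
Proof.
move=> cf; have [M0|M0] := leP 0 M; last first.
  exists 0 => // y yM; have := le_lt_trans (le_trans (normr_ge0 y) yM) M0.
  by rewrite ltxx.
have cN : continuous (fun y : 'rV[R]_n => `|f y|).
  by move=> y; exact: (continuous_comp (cf y) (@norm_continuous _ _ _)).
pose A := [set y : 'rV[R]_n | `|y| <= M].
have cA : compact A.
  apply: bounded_closed_compact.
    exists M; split; first exact: num_real.
    by move=> M' MM' y /= yM; rewrite (le_trans yM)// ltW.
  rewrite (_ : A = (fun y => `|y|) @^-1` [set x | x <= M])//.
  apply: preimage_closed; first by move=> y _; exact: norm_continuous.
  exact: closed_le.
have [|c _ Hc] := @EVT_max_rV _ _ _ A _ cA (continuous_subspaceT cN).
  by exists 0; rewrite /A/= normr0.
exists `|f c| => // y yM.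
by apply: Hc; rewrite inE.
Qed.

(** Differentiating [f (t *: y)] in [y] produces a factor [t]; the weight [t ^+ m] keeps these
    integrals closed under partial derivatives. *)
Definition ray_integral n (m : nat) (f : 'rV[R]_n -> R) (y : 'rV[R]_n) : R :=
  int01 (fun t => t ^+ m * f (t *: y)).

Lemma continuous_ray n (m : nat) (f : 'rV[R]_n -> R) (y : 'rV[R]_n) :
  continuous f -> continuous (fun t : R => t ^+ m * f (t *: y)).
Proof.
move=> cf; apply: funM_continuous; first exact: exprn_continuous.
move=> t; have cs : {for t, continuous (fun t : R => t *: y)}.
  exact: scalel_continuous.
exact: (continuous_comp cs (cf _)).
Qed.

Lemma norm_delta n (i : 'I_n) : `|'e_i : 'rV[R]_n| <= 1.
Proof.
apply: norm_le_coord => // j; rewrite mxE/=.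
by case: (j == i); rewrite ?normr1 ?normr0.
Qed.

(** An explicit estimate replaces dominated convergence: two mean value steps bound the integrand
    [k] of the error by [|h| * C], where [C] bounds the second partial derivative on the ball of
    radius [|y| + 1]. *)
Lemma is_derive_ray n m (f : 'rV[R]_n -> R) i y : class_C 2%N setT f ->
  is_derive y 'e_i (ray_integral m f)
    (ray_integral m.+1 (fun x => 'D_'e_i f x) y).
Proof.
move=> Cf; have C1f : class_C 1%N setT (fun x => 'D_'e_i f x).
  exact: (@class_C_partial _ _ 1 f i Cf).
have C2f : class_C 0 setT (fun x => 'D_'e_i (fun y => 'D_'e_i f y) x).
  exact: (@class_C_partial _ _ 0 _ i C1f).
have cf := class_C_continuous Cf.
have cdf := class_C_continuous C1f.
have [C C0 HC] := continuous_bounded_ball (`|y| + 1) (class_C_continuous C2f).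
have C1 : 0 < C + 1 by rewrite ltr_wpDl.
apply/is_deriveP/cvgrPdist_lt => e e0; near=> h.
have h0 : h != 0 by near: h; exact: nbhs_dnbhs_neq.
have h1 : `|h| < 1 by near: h; exact: dnbhs0_lt.
rewrite distrC.
set k := fun t : R => h^-1 * (t ^+ m * f (t *: (h *: 'e_i + y)) -
  t ^+ m * f (t *: y)) - t ^+ m.+1 * 'D_'e_i f (t *: y).
have cr g z p := @continuous_ray n p g z.
have ck : continuous (fun t : R => t ^+ m * f (t *: (h *: 'e_i + y)) -
    t ^+ m * f (t *: y)).
  by apply: funB_continuous; exact: cr.
have chk : continuous (fun t : R => h^-1 *
    (t ^+ m * f (t *: (h *: 'e_i + y)) - t ^+ m * f (t *: y))).
  by apply: funM_continuous => //; exact: cst_continuous.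
have -> : h^-1 *: (ray_integral m f (h *: 'e_i + y) - ray_integral m f y) -
    ray_integral m.+1 (fun x => 'D_'e_i f x) y = int01 k.
  rewrite /k (int01B chk (cr _ _ _ cdf)) int01Z// int01B//; exact: cr.
apply: (@le_lt_trans _ _ (`|h| * C)); last first.
  apply: (@le_lt_trans _ _ (`|h| * (C + 1))); first by rewrite ler_wpM2l// lerDl.
  by rewrite -ltr_pdivlMr//; near: h; apply: dnbhs0_lt; exact: divr_gt0.
apply: int01_norm_le => [|t /andP[t0 t1]].
  apply: funB_continuous; first exact: chk.
  exact: (cr _ y m.+1 cdf).
have tn : `|t| <= 1 by rewrite ger0_norm.
have thn : `|t * h| <= `|h| by rewrite normrM ler_piMl.
have [a ah Ea] := @MVT_line _ _ f 'e_i (t *: y) (t * h)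
  (fun z => @class_C_derivable _ _ 1 f i z Cf).
have [b bh Eb] := @MVT_line _ _ (fun z => 'D_'e_i f z) 'e_i (t *: y) a
  (fun z => @class_C_derivable _ _ 0 _ i z C1f).
have -> : k t = t ^+ m * t * (a * 'D_'e_i (fun z => 'D_'e_i f z) (b *: 'e_i + t *: y)).
  rewrite -Eb /k scalerDr scalerA -mulrBr Ea exprSr.
  by field.
have b1 : `|b| <= 1 by rewrite (le_trans bh)// (le_trans ah)// (le_trans thn)// ltW.
rewrite -exprSr normrM normrX -[leRHS]mul1r ler_pM//; first by rewrite exprn_ile1.
rewrite normrM ler_pM// ?(le_trans ah)//; apply: HC.
rewrite addrC (le_trans (ler_normD _ _))// lerD// normrZ.
  by rewrite ler_piMl.
by rewrite mulr_ile1// norm_delta.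
Unshelve. all: by end_near. Qed.

(** The function is Lipschitz on the unit ball around [x]: the intermediate points of the mean value
    theorem have norm at most [|x - y| + |y| <= |x| + 2], and the gradient is bounded on that
    ball. *)
Lemma continuous_ray_integral n m (f : 'rV[R]_n -> R) : class_C 1%N setT f ->
  continuous (ray_integral m f).
Proof.
move=> Cf x; have cf := class_C_continuous Cf.
have H j : {C | 0 <= C & forall y, `|y| <= `|x| + 2 -> `|'D_'e_j f y| <= C}.
  apply/cid2/continuous_bounded_ball.
  exact: (class_C_continuous (@class_C_partial _ _ 0 f j Cf)).
pose K := 1 + \sum_j s2val (H j).
have K0 : 0 < K.
  by rewrite ltr_pwDl// sumr_ge0// => j _; case: (H j).
suff L y : `|x - y| < 1 ->
    `|ray_integral m f x - ray_integral m f y| <= K * `|x - y|.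
  change (ray_integral m f @ x --> ray_integral m f x).
  apply: (@cvgrPdist_lt _ _ _ (nbhs x) _ _ _).2 => e e0; apply/nbhs_ballP.
  exists (Num.min 1 (e / K)) => [|y] /=; first by rewrite lt_min ltr01 divr_gt0.
  rewrite -ball_normE /ball_/= lt_min => /andP[xy1 xye].
  by rewrite (le_lt_trans (L _ xy1))// mulrC -ltr_pdivlMr.
move=> xy1; have cr := @continuous_ray n m f _ cf.
rewrite -int01B//; apply: int01_norm_le => [|t /andP[t0 t1]].
  by apply: funB_continuous; exact: cr.
have tn : `|t| <= 1 by rewrite ger0_norm.
rewrite -mulrBr normrM normrX -[leRHS]mul1r ler_pM ?exprn_ile1//.
have [z|c c1] := @MVT_line _ _ f (t *: (x - y)) (t *: y) 1.
  exact: derivable_dir.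
rewrite scale1r -scalerDr subrK mul1r => ->.
rewrite derive_dir// (le_trans (ler_norm_sum _ _ _))//.
rewrite /K mulrDl mul1r ler_wpDl// mulr_suml ler_sum// => j _.
rewrite normrM mulrC ler_pM//; last first.
  rewrite (le_trans (coord_le_norm _ _))// normrZ.
  by rewrite ler_piMl.
case: (H j) => C /= _; apply.
rewrite normr1 in c1; have yx : `|y| <= `|x| + 1.
  rewrite -(subrKC x y) (le_trans (ler_normD _ _))// lerD2l distrC ltW//.
rewrite (le_trans (ler_normD _ _))//.
rewrite (_ : `|x| + 2 = 1 + (`|x| + 1)); last by ring.
rewrite addrC [leRHS]addrC lerD//.
  by rewrite normrZ (le_trans _ yx)// ler_piMl.
by rewrite !normrZ mulr_ile1// ?mulr_ge0// mulr_ile1// ltW.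
Qed.

Lemma class_C_ray_integral n k m (f : 'rV[R]_n -> R) : smooth_on setT f ->
  class_C k setT (ray_integral m f).
Proof.
elim: k m f => [|k IH] m f Sf.
  by split=> // x _; exact: continuous_ray_integral (Sf 1%N) x.
split=> [x _|i]; first exact: continuous_ray_integral (Sf 1%N) x.
split=> [x _|]; first by have [] := is_derive_ray m i x (Sf 2%N).
apply: (@eq_class_C _ _ _ _ _ (ray_integral m.+1 (fun x => 'D_'e_i f x))) => [x|].
  by have /@derive_val := is_derive_ray m i x (Sf 2%N).
by apply: IH => l; exact: class_C_partial.
Qed.

Lemma is_derive_along_ray n (f : 'rV[R]_n -> R) y (t : R) : class_C 1%N setT f ->
  is_derive t 1 (fun h : R => f (h *: y)) (\sum_j y ord0 j * 'D_'e_j f (t *: y)).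
Proof.
move=> Cf.
have : is_derive t 1 (fun h : R => f (h *: y + 0))
    (\sum_j y ord0 j * 'D_'e_j f (t *: y)).
  by apply: is_derive_line; rewrite addr0; exact: is_derive_dir.
by under eq_fun do rewrite addr0.
Qed.

(** This is the integral over [[0, 1]] of the derivative of [t |-> f (t *: y)]. Its point is that
    the coefficients are ray integrals, hence smooth in [y]. *)
Lemma hadamard0 n (f : 'rV[R]_n -> R) y : smooth_on setT f ->
  f y = f 0 + \sum_j y ord0 j * ray_integral 0 (fun x => 'D_'e_j f x) y.
Proof.
move=> Sf; have cdf j : continuous (fun x => 'D_'e_j f x).
  exact: (class_C_continuous (@class_C_partial _ _ 0 f j (Sf 1%N))).
have cr j : continuous (fun t : R => 'D_'e_j f (t *: y)).
  by have := @continuous_ray n 0 _ y (cdf j); under eq_fun do rewrite mul1r.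
have cyr j : continuous (fun t : R => y ord0 j * 'D_'e_j f (t *: y)).
  by apply: funM_continuous => //; exact: cst_continuous.
have -> : \sum_j y ord0 j * ray_integral 0 (fun x => 'D_'e_j f x) y =
    int01 (fun t : R => \sum_j y ord0 j * 'D_'e_j f (t *: y)).
  rewrite int01_sum//; apply: eq_bigr => j _; rewrite int01Z//.
  by rewrite /ray_integral; under eq_fun do rewrite mul1r.
have -> : int01 (fun t : R => \sum_j y ord0 j * 'D_'e_j f (t *: y)) =
    f (1 *: y) - f (0 *: y).
  apply: (@int01_FTC _ _ (fun t => f (t *: y))); first exact: funsum_continuous.
  by move=> t _; exact: is_derive_along_ray (Sf 1%N).
by rewrite scale1r scale0r subrKC.
Qed.

(* The primitive is [f x = \sum_j x_j \int_0^1 w_j (t x) dt]; closedness turns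
   its partial derivatives into [\int_0^1 d/dt (t w_i (t x)) dt]. *)
Lemma poincare n (w : 'I_n -> 'rV[R]_n -> R) :
  (forall i, smooth_on setT (w i)) ->
  (forall i j x, 'D_'e_i (w j) x = 'D_'e_j (w i) x) ->
  exists2 f, smooth_on setT f & forall i x, 'D_'e_i f x = w i x.
Proof.
move=> Sw closed_w.
pose G j := ray_integral 0 (w j).
have CG j k : class_C k setT (G j) by exact: class_C_ray_integral.
exists (fun x : 'rV[R]_n => \sum_j x ord0 j * G j x) => [k|i x].
  by apply: class_C_sum => j _; apply: class_CM; first exact: class_C_coord.
have D : is_derive x 'e_i (fun x : 'rV[R]_n => \sum_j x ord0 j * G j x)
    (\sum_j (x ord0 j * 'D_'e_i (G j) x + G j x * ('e_i : 'rV[R]_n) ord0 j)).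
  rewrite [X in is_derive _ _ X](_ : _ = \sum_j (fun x : 'rV[R]_n => x ord0 j * G j x)).
    by apply: is_derive_sum => j; apply: is_deriveM;
      [exact: is_derive_coord|exact/derivableP/(@class_C_derivable _ _ 0 (G j))].
  by apply/funext => z; rewrite fct_sumE.
have /@derive_val -> := D; rewrite big_split/= [X in _ + X](bigD1 i)//=.
rewrite [X in _ + (_ + X)]big1 ?addr0 => [|j /negbTE ji]; last first.
  by rewrite mxE ji andbF mulr0.
rewrite mxE !eqxx mulr1.
have cw j : continuous (w j) by exact: class_C_continuous (Sw j 0%N).
have cdw j l : continuous (fun x => 'D_'e_l (w j) x).
  exact: (class_C_continuous (@class_C_partial _ _ 0 (w j) l (Sw j 1%N))).
have cr j m (g : 'rV[R]_n -> R) : continuous g ->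
    continuous (fun t : R => x ord0 j * (t ^+ m * g (t *: x))).
  move=> cg; apply: funM_continuous; first exact: cst_continuous.
  exact: continuous_ray.
have -> : \sum_j x ord0 j * 'D_'e_i (G j) x =
    int01 (fun t : R => \sum_j x ord0 j * (t ^+ 1 * 'D_'e_j (w i) (t *: x))).
  rewrite int01_sum => [|j]; last exact: (cr j 1%N _ (cdw i j)).
  apply: eq_bigr => j _; rewrite int01Z; last exact: (@continuous_ray _ 1 _ x (cdw i j)).
  congr (_ * _); have /@derive_val -> := is_derive_ray 0 i x (Sw j 2%N).
  by rewrite /ray_integral; congr int01; apply/funext => t; rewrite closed_w.
rewrite /G /ray_integral -int01D; last exact: (@continuous_ray _ 0 _ x (cw i)).
  have -> : int01 (fun t : R =>
      \sum_j x ord0 j * (t ^+ 1 * 'D_'e_j (w i) (t *: x)) +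
      t ^+ 0 * w i (t *: x)) = 1 * w i (1 *: x) - 0 * w i (0 *: x).
    apply: (@int01_FTC _ _ (fun t => t * w i (t *: x))) => [|t _].
      apply: funD_continuous; last exact: (@continuous_ray _ 0 _ x (cw i)).
      by apply: funsum_continuous => j; exact: (cr j 1%N _ (cdw i j)).
    have := @is_deriveM _ _ id (fun t => w i (t *: x)) t 1 1 _ (is_derive_id _ _)
      (is_derive_along_ray x t (Sw i 1%N)).
    move=> /is_derive_eq; apply; rewrite /GRing.scale/= expr0 mul1r mulr1; congr (_ + _).
    by rewrite mulr_sumr; apply: eq_bigr => j _; rewrite expr1 mulrCA.
  by rewrite mul1r mul0r subr0 scale1r.
by apply: funsum_continuous => j; exact: (cr j 1%N _ (cdw i j)).
Qed.

End RayIntegral.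

(** * Bump functions *)

Section Bump.
Context {R : realType}.

(** For positive [i], [expR u] is the [i]-th power of [expR (u / i)], which is at least [u / i]. *)
Lemma pow_le_expR i (u : R) : 0 <= u -> u ^+ i <= i%:R ^+ i * expR u.
Proof.
case: i => [|i] u0; first by rewrite !expr0 mul1r -expR0 ler_expR.
have i0 : (0 : R) < i.+1%:R by rewrite ltr0n.
have -> : expR u = expR (u / i.+1%:R) ^+ i.+1.
  by rewrite -expRM_natl mulrC divfK// gt_eqF.
rewrite -exprMn lerXn2r// ?nnegrE ?mulr_ge0 ?expR_ge0//.
rewrite mulrC -ler_pdivrMr// (le_trans _ (expR_ge1Dx _))//.
by rewrite lerDr.
Qed.

Lemma horner_le_expR (P : {poly R}) :
  exists2 C, 0 <= C & forall u, 0 <= u -> `|P.[u]| <= C * expR u.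
Proof.
exists (\sum_(i < size P) `|P`_i| * i%:R ^+ i) => [|u u0].
  by rewrite sumr_ge0// => i _; rewrite mulr_ge0// exprn_ge0.
rewrite horner_coef (le_trans (ler_norm_sum _ _ _))// mulr_suml ler_sum// => i _.
by rewrite normrM -mulrA ler_wpM2l// ger0_norm ?exprn_ge0// pow_le_expR.
Qed.

(* Polynomials in [1/t] make the family of these flat functions closed under
   derivation. *)
Definition flat_exp (P : {poly R}) (t : R) : R :=
  if 0 < t then P.[t^-1] * expR (- t^-1) else 0.

Lemma flat_exp_le0 P t : t <= 0 -> flat_exp P t = 0.
Proof. by move=> t0; rewrite /flat_exp ltNge t0. Qed.

(** The growth bound is applied to [P * 'X] at [t^-1]; the extra factor ['X] is what yields
    [|t|]. *)
Lemma flat_exp_linear_bound P : exists2 C, 0 <= C &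
  forall t, `|flat_exp P t| <= C * `|t|.
Proof.
have [C C0 HC] := horner_le_expR (P * 'X).
exists C => // t; rewrite /flat_exp; case: ifPn => [t0|_]; last first.
  by rewrite normr0 mulr_ge0.
have it0 : 0 <= t^-1 by rewrite invr_ge0 ltW.
have := HC _ it0; rewrite hornerMX normrM (ger0_norm it0) => H.
rewrite normrM (ger0_norm (expR_ge0 _)) expRN ler_pdivrMr ?expR_gt0//.
by rewrite (gtr0_norm t0) mulrAC -ler_pdivrMr.
Qed.

(** For [t > 0], the derivative of [P(1/t) exp(-1/t)] is [t^-2 (P - P')(1/t) exp(-1/t)]. At 0 the
    difference quotient is [flat_exp ('X * P) h], which tends to 0 by the linear bound. *)
Lemma is_derive_flat_exp P (t : R) :
  is_derive t 1 (flat_exp P) (flat_exp ('X^2 * (P - P^`())) t).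
Proof.
have [t0|t0|->] := ltgtP t 0.
- rewrite [X in is_derive _ _ _ X](_ : _ = 0); last by rewrite flat_exp_le0// ltW.
  apply: (@near_eq_is_derive _ _ _ (cst 0)).
  near=> s; rewrite flat_exp_le0//.
  by apply/ltW; near: s; exact: lt_nbhsl.
- apply: (@near_eq_is_derive _ _ _ (fun s : R => P.[s^-1] * expR (- s^-1))).
    near=> s; rewrite /flat_exp ifT//; near: s; exact: lt_nbhsr.
  have tn0 : t != 0 by rewrite gt_eqF.
  have dV : is_derive t 1 (fun s : R => s^-1) (- t ^- 2).
    apply: DeriveDef; first exact: derivableV.
    by rewrite deriveV// derive_id /GRing.scale/= mulr1.
  have dP : is_derive t 1 (fun s : R => P.[s^-1]) (P^`().[t^-1] * - t ^- 2).
    exact: (@is_derive1_comp _ (horner P) (fun s : R => s^-1) t _ _ (is_derive_poly P t^-1) dV).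
  have dE : is_derive t 1 (fun s : R => expR (- s^-1)) (expR (- t^-1) * t ^- 2).
    have := @is_derive1_comp _ expR (fun s : R => - s^-1) t _ _ (is_derive_expR _) _.
    by apply; rewrite -[X in is_derive _ _ _ X]opprK; exact: is_deriveN.
  have := is_deriveM dP dE; move=> /is_derive_eq; apply.
  rewrite /flat_exp t0 /GRing.scale/= hornerM hornerXn hornerD hornerN -exprVn.
  by ring.
have flat0 Q : flat_exp Q 0 = 0 by exact: flat_exp_le0.
rewrite flat0.
apply/is_deriveP; have [C C0 HC] := flat_exp_linear_bound ('X * P).
apply/cvgrPdist_lt => e e0; near=> h.
have h0 : h != 0 by near: h; exact: nbhs_dnbhs_neq.
rewrite addr0 scaler1 flat0 subr0 sub0r normrN.
have -> : h^-1 *: flat_exp P h = flat_exp ('X * P) h.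
  rewrite /flat_exp; case: ifP => _; last by rewrite scaler0.
  by rewrite hornerM hornerX /GRing.scale/= mulrA.
have C1 : 0 < C + 1 by rewrite ltr_wpDl.
apply: (@le_lt_trans _ _ ((C + 1) * `|h|)).
  by rewrite (le_trans (HC _))// ler_wpM2r// lerDl.
rewrite mulrC -ltr_pdivlMr//; near: h; apply: dnbhs0_lt.
by rewrite divr_gt0// ltr_wpDl.
Unshelve. all: by end_near. Qed.

Let psi (t : R) := flat_exp 1 t.

Let psi_gt0 t : (0 < psi t) = (0 < t).
Proof.
case: (ltP 0 t) => t0; last by rewrite /psi flat_exp_le0// ltxx.
by rewrite /psi /flat_exp t0 hornerC mul1r expR_gt0.
Qed.

Let psi_ge0 t : 0 <= psi t.
Proof.
rewrite /psi /flat_exp; case: ifP => // _.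
by rewrite hornerC mul1r expR_ge0.
Qed.

Let psi_eq0 t : t <= 0 -> psi t = 0.
Proof. exact: flat_exp_le0. Qed.

Lemma norm_lt_coord n (x : 'rV[R]_n) M : 0 < M ->
  (forall j, `|x ord0 j| < M) -> `|x| < M.
Proof.
move=> M0 H; rewrite /Num.Def.normr/= mx_normrE.
by apply: bigmax_lt => // -[i j] _; rewrite ord1; exact: H.
Qed.

(** The bump is [N / (N + D)]: [N] is positive exactly when all coordinates are below 1/4 in
    absolute value, and [D] exactly when one exceeds 1/8, so the denominator never vanishes. Squares
    of coordinates, compared with 1/16 and 1/64, avoid the nonsmooth absolute value. *)
Lemma smooth_bump n : exists b : 'rV[R]_n -> R, [/\ smooth_on setT b,
  forall y, `|y| <= 8^-1 -> b y = 1 & forall y, 4^-1 <= `|y| -> b y = 0].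
Proof.
pose N (y : 'rV[R]_n) := \prod_j psi (16^-1 - y ord0 j * y ord0 j).
pose D (y : 'rV[R]_n) := \sum_j psi (y ord0 j * y ord0 j - 64^-1).
have N0 y : 0 <= N y by rewrite prodr_ge0.
have D0 y : 0 <= D y by rewrite sumr_ge0.
have sq (a c : R) : 0 <= c -> (a * a <= c * c) = (`|a| <= c).
  by move=> c0; rewrite -!expr2 -(real_normK (num_real a)) ler_sqr// nnegrE.
have sqlt (a c : R) : 0 <= c -> (a * a < c * c) = (`|a| < c).
  by move=> c0; rewrite -!expr2 -(real_normK (num_real a)) ltr_sqr// nnegrE.
have e16 : (16^-1 : R) = 4^-1 * 4^-1 by field.
have e64 : (64^-1 : R) = 8^-1 * 8^-1 by field.
have Npos y : `|y| <= 8^-1 -> 0 < N y.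
  move=> y8; rewrite prodr_gt0// => j _; rewrite psi_gt0 subr_gt0 e16 sqlt//.
  by rewrite (le_lt_trans (coord_le_norm _ _))// (le_lt_trans y8)//; lra.
have Deq0 y : `|y| <= 8^-1 -> D y = 0.
  move=> y8; rewrite /D big1// => j _; rewrite psi_eq0// subr_le0 e64 sq//.
  by rewrite (le_trans (coord_le_norm _ _)).
have ND y : N y + D y != 0.
  rewrite gt_eqF//; have [y8|y8] := leP `|y| 8^-1; first by rewrite ltr_pwDl ?Npos.
  rewrite ltr_wpDl// lt_neqAle D0 andbT eq_sym; apply: contraTN y8 => Dy0.
  rewrite -leNgt; apply: norm_le_coord => // j.
  rewrite -sq// -e64 -subr_le0 leNgt -psi_gt0 -leNgt.
  move: Dy0; rewrite psumr_eq0// => /allP/(_ j); rewrite mem_index_enum => /(_ isT).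
  by move=> /eqP ->.
exists (fun y => N y * (N y + D y)^-1); split => [k|y y8|y y4].
- have Cpsi q : class_C k setT q -> class_C k setT (fun y : 'rV[R]_n => psi (q y)).
    exact: (class_C_comp1 is_derive_flat_exp).
  have CN' : class_C k setT N.
    apply: class_C_prod => j _; apply: Cpsi; apply: class_CB.
      exact: class_C_cst.
    by apply: class_CM; exact: class_C_coord.
  apply: class_CM => //; apply: class_CV => //; apply: class_CD => //.
  apply: class_C_sum => j _; apply: Cpsi; apply: class_CB; last exact: class_C_cst.
  by apply: class_CM; exact: class_C_coord.
- by rewrite Deq0// addr0 divff// gt_eqF ?Npos.
- suff -> : N y = 0 by rewrite mul0r.
  have [/forallP H|/forallPn[j]] := boolP [forall j, `|y ord0 j| < 4^-1].
    have q0 : (0 : R) < 4^-1 by rewrite invr_gt0.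
    by have := le_lt_trans y4 (norm_lt_coord q0 H); rewrite ltxx.
  rewrite -leNgt => yj; apply/eqP/prodf_eq0; exists j => //.
  by rewrite psi_eq0// subr_le0 e16 leNgt sqlt// -leNgt.
Qed.

End Bump.

(** * Vector fields on flat manifolds *)

Section FlatCover.
Context {R : realType} (n : nat).

(** [cover_smooth] is the only link with the atlas, so that quotients and their products are treated
    alike. The bound 1 in [cover_free] makes [p] injective on balls of radius 1/2; the uniform
    constant in [cover_lipschitz] controls a whole orbit at once. *)
Record flat_cover (M : atlas_space R n) (p : 'rV[R]_n -> M)
    (G : set ('rV[R]_n -> 'rV[R]_n)) : Prop := FlatCover {
  cover_surj : forall q, exists x, p x = q;
  cover_orbit : forall x y, p x = p y <-> exists2 g, G g & y = g x;
  cover_affine : forall g, G g -> exists L v, g = fun x => x *m L + v;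
  cover_lipschitz : exists2 K, 0 < K &
    forall g, G g -> forall x y, `|g x - g y| <= K * `|x - y|;
  cover_free : forall g x, G g -> `|g x - x| < 1 -> g = id;
  cover_smooth : forall f : M -> R, smooth_fun f <-> smooth_on setT (f \o p) }.

Variables (M : atlas_space R n) (p : 'rV[R]_n -> M).
Variable G : set ('rV[R]_n -> 'rV[R]_n).
Hypothesis cov : flat_cover p G.

Lemma cover_inj x0 x y : `|x0 - x| < 2^-1 -> `|x0 - y| < 2^-1 -> p x = p y ->
  x = y.
Proof.
move=> x2 y2 /(cover_orbit cov)[g Gg yE]; rewrite yE (cover_free cov Gg (x := x))//.
rewrite -yE -(subrKA x0) addrC (splitr 1) (le_lt_trans (ler_normD _ _))//.
by rewrite ltrD// mul1r// distrC.
Qed.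

(* [h] on the ball of radius 1/2 at [x0], on which [p] is injective, seen as a
   function on [M] and extended by 0. *)
Definition transfer (x0 : 'rV[R]_n) (h : 'rV[R]_n -> R) (q : M) : R :=
  if pselect (exists2 y, `|x0 - y| < 2^-1 & p y = q) is left e
  then h (s2val (cid2 e)) else 0.

Lemma transferE x0 h y : `|x0 - y| < 2^-1 -> transfer x0 h (p y) = h y.
Proof.
move=> y2; rewrite /transfer; case: pselect => [e|[]]; last by exists y.
by case: (cid2 e) => z /= z2 /(cover_inj z2 y2) ->.
Qed.

Lemma transfer0 x0 h q : ~ (exists2 y, `|x0 - y| < 2^-1 & p y = q) ->
  transfer x0 h q = 0.
Proof. by rewrite /transfer; case: pselect. Qed.

Lemma cover_continuous g : G g -> continuous g.
Proof. by move=> /(cover_affine cov)[L [v ->]]; exact: affine_continuous. Qed.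

(** Either some [g] moves [x] into the ball of radius 1/2, and the lift is [h \o g] nearby; or the
    orbit of [x] stays at distance at least 1/2 from [x0]. In the latter case the orbits of all
    points within [1 / (4 K)] of [x] stay at distance at least 1/4, where [h] vanishes. *)
Lemma smooth_transfer x0 h : smooth_on setT h ->
  (forall y, 4^-1 <= `|x0 - y| -> h y = 0) -> smooth_fun (transfer x0 h).
Proof.
move=> Sh h0; apply/(cover_smooth cov) => k.
apply: class_C_local => x _.
have [[g Gg gx]|H] := pselect (exists2 g, G g & `|x0 - g x| < 2^-1).
  exists [set z | `|x0 - g z| < 2^-1], (h \o g); split => //.
  - rewrite (_ : [set z | _] = g @^-1` ball x0 2^-1).
      by apply: open_comp => [z _|]; [exact: cover_continuous|exact: ball_open].
    by rewrite -ball_normE.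
  - have [L [v ->]] := cover_affine cov Gg.
    exact: class_CT (class_C_affine L v (Sh k)).
  - move=> z; rewrite inE/= => z2; rewrite -(transferE h z2); congr transfer.
    by apply/(cover_orbit cov); exists g.
have [K K0 HK] := cover_lipschitz cov.
exists (ball x (4^-1 / K)), (fun=> 0); split.
- exact: ball_open.
- by apply: ballxx; rewrite divr_gt0.
- exact/class_CT/class_C_cst.
move=> z; rewrite inE -ball_normE /ball_/= => xz.
have [[y y2 yz]|] := pselect (exists2 y, `|x0 - y| < 2^-1 & p y = p z); last first.
  exact: transfer0.
rewrite -yz transferE//; apply: h0.
have /(cover_orbit cov)[g Gg yE] : p z = p y by [].
have gx : 2^-1 <= `|x0 - g x| by rewrite leNgt; apply/negP => ?; apply: H; exists g.
have gxz : `|g z - g x| <= 4^-1.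
  rewrite (le_trans (HK _ Gg _ _))// mulrC -ler_pdivlMr// distrC ltW//.
have := ler_normD (x0 - g z) (g z - g x); rewrite subrKA -yE => H1.
by rewrite yE; rewrite yE in H1; lra.
Qed.

Definition bump_fun : 'rV[R]_n -> R := sval (cid (@smooth_bump R n)).

Lemma smooth_bump_shift x0 : smooth_on setT (fun y => bump_fun (y - x0)).
Proof.
move=> k; have [Sb _ _] := svalP (cid (@smooth_bump R n)).
apply: (@eq_class_C _ _ _ _ _ (fun y => bump_fun (y *m 1%:M + - x0))) => [y|].
  by rewrite mulmx1.
exact: class_C_affine (Sb k).
Qed.

Lemma bump1 y : `|y| <= 8^-1 -> bump_fun y = 1.
Proof. by have [_ H _] := svalP (cid (@smooth_bump R n)); exact: H. Qed.

Lemma bump0 y : 4^-1 <= `|y| -> bump_fun y = 0.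
Proof. by have [_ _ H] := svalP (cid (@smooth_bump R n)); exact: H. Qed.

Lemma smooth_transfer_bump x0 h : smooth_on setT h ->
  smooth_fun (transfer x0 (fun y => bump_fun (y - x0) * h y)).
Proof.
move=> Sh; apply: smooth_transfer => [k|y y4].
  by apply: class_CM; [exact: smooth_bump_shift|exact: Sh].
by rewrite bump0 ?mul0r// distrC.
Qed.

(** A derivation is only controlled on globally smooth functions, so the coordinate centred at [x0]
    is cut off by a bump; it is unchanged within distance 1/8. *)
Definition local_coord x0 j := transfer x0 (fun y => bump_fun (y - x0) * (y ord0 j - x0 ord0 j)).

Lemma smooth_local_coord x0 j : smooth_fun (local_coord x0 j).
Proof.
apply: smooth_transfer_bump => k; apply: class_CB; last exact: class_C_cst.
exact: class_C_coord.
Qed.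

Lemma local_coordE x0 j y : `|x0 - y| < 8^-1 ->
  local_coord x0 j (p y) = y ord0 j - x0 ord0 j.
Proof.
move=> y8; have y2 : `|x0 - y| < 2^-1 by rewrite (lt_trans y8)//; lra.
by rewrite /local_coord transferE// bump1 ?mul1r// distrC ltW.
Qed.

Lemma partial_local_coord x0 j y v : `|x0 - y| < 8^-1 ->
  'D_v (local_coord x0 j \o p) y = v ord0 j.
Proof.
move=> y8; rewrite (@near_eq_derive _ _ _ _ (fun z : 'rV[R]_n => z ord0 j - x0 ord0 j)).
  have := @is_deriveB _ _ _ (fun z : 'rV[R]_n => z ord0 j) (cst (x0 ord0 j)) y v _ _
    (is_derive_coord j y v) (is_derive_cst _ _ _).
  by rewrite subr0 => /@derive_val.
apply/nbhs_ballP; exists (8^-1 - `|x0 - y|) => /=; first by rewrite subr_gt0.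
move=> z; rewrite -ball_normE /ball_/= => yz; apply: local_coordE.
rewrite -(subrKA y) (le_lt_trans (ler_normD _ _))//.
by rewrite addrC -ltrBrDr.
Qed.

Lemma smooth_funD (f g : M -> R) : smooth_fun f -> smooth_fun g ->
  smooth_fun (fun q => f q + g q).
Proof.
move=> /(cover_smooth cov) Sf /(cover_smooth cov) Sg.
by apply/(cover_smooth cov) => k; apply: class_CD; [exact: Sf|exact: Sg].
Qed.

Lemma smooth_funM (f g : M -> R) : smooth_fun f -> smooth_fun g ->
  smooth_fun (fun q => f q * g q).
Proof.
move=> /(cover_smooth cov) Sf /(cover_smooth cov) Sg.
by apply/(cover_smooth cov) => k; apply: class_CM; [exact: Sf|exact: Sg].
Qed.

Lemma smooth_fun_cst c : smooth_fun (fun _ : M => c).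
Proof. by apply/(cover_smooth cov) => k; exact: class_C_cst. Qed.

Section Tangent.
Variables (x0 : 'rV[R]_n) (v : (M -> R) -> R).
Hypothesis tv : tangent_vector (p x0) v.

Lemma tangent_cst c : v (fun=> c) = 0.
Proof.
have [vL vM] := tv.
have v1 : v (fun=> 1) = 0.
  have := vM _ _ (smooth_fun_cst 1) (smooth_fun_cst 1).
  have -> : (fun _ : M => 1 * 1 : R) = fun=> 1 by apply/funext => q; rewrite mulr1.
  by rewrite mul1r => /eqP; rewrite -subr_eq subrr => /eqP.
have v0 : v (fun=> 0) = 0.
  have := vL 1 _ _ (smooth_fun_cst 0) (smooth_fun_cst 0).
  have -> : (fun _ : M => 1 * 0 + 0 : R) = fun=> 0 by apply/funext => q; rewrite mulr0 addr0.
  by rewrite mul1r => /eqP; rewrite -subr_eq subrr => /eqP.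
have := vL c _ _ (smooth_fun_cst 1) (smooth_fun_cst 0).
have -> : (fun _ : M => c * 1 + 0 : R) = fun=> c by apply/funext => q; rewrite mulr1 addr0.
by rewrite v1 v0 mulr0 addr0.
Qed.

Lemma tangentD f g : smooth_fun f -> smooth_fun g ->
  v (fun q => f q + g q) = v f + v g.
Proof.
move=> Sf Sg; rewrite -[X in X + _]mul1r -tv.1//; congr v.
by apply/funext => q; rewrite mul1r.
Qed.

Lemma tangent_sum m (f : 'I_m -> M -> R) : (forall i, smooth_fun (f i)) ->
  v (fun q => \sum_i f i q) = \sum_i v (f i).
Proof.
move=> Sf.
suff : v (fun q => \sum_(i <- index_enum 'I_m) f i q) =
    \sum_(i <- index_enum 'I_m) v (f i) /\
    smooth_fun (fun q => \sum_(i <- index_enum 'I_m) f i q) by case.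
elim: (index_enum _) => [|i r [IH Sr]].
  rewrite big_nil; under eq_fun do rewrite big_nil.
  by split; [exact: tangent_cst|exact: smooth_fun_cst].
rewrite big_cons; under eq_fun do rewrite big_cons.
by rewrite tangentD// IH; split => //; exact: smooth_funD.
Qed.

(* Hadamard's lemma writes [b^2 (f - f (p x0))], with [b] a bump function at
   [x0], as a sum of products of local coordinates and smooth functions. *)
Lemma tangent_vectorE f : smooth_fun f ->
  v f = \sum_j v (local_coord x0 j) * 'D_'e_j (f \o p) x0.
Proof.
move=> Sf; have [vL vM] := tv.
have SF := (cover_smooth cov f).1 Sf.
have x00 : `|x0 - x0| < 2^-1 by rewrite subrr normr0 invr_gt0.
pose F0 z := f (p (z + x0)).
have SF0 : smooth_on setT F0.
  move=> k; apply: (@eq_class_C _ _ _ _ _ (fun z => (f \o p) (z *m 1%:M + x0))) => [z|].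
    by rewrite mulmx1.
  exact: class_C_affine (SF k).
pose h j y := ray_integral 0 (fun z => 'D_'e_j F0 z) (y - x0).
have Sh j : smooth_on setT (h j).
  move=> k; apply: (@eq_class_C _ _ _ _ _
    (fun y => ray_integral 0 (fun z => 'D_'e_j F0 z) (y *m 1%:M + - x0))) => [z|].
    by rewrite mulmx1.
  apply: class_C_affine; apply: class_C_ray_integral => l.
  exact: (@class_C_partial _ _ l F0 j (SF0 _)).
pose H j := transfer x0 (fun y => bump_fun (y - x0) * h j y).
have SH j : smooth_fun (H j) by exact: smooth_transfer_bump.
pose b := transfer x0 (fun y => bump_fun (y - x0) * 1).
have Sb : smooth_fun b by apply: smooth_transfer_bump => k; exact: class_C_cst.
have b1 : b (p x0) = 1 by rewrite /b transferE// subrr bump1 ?mulr1 ?normr0.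
pose f0 q := f q + - f (p x0).
have Sf0 : smooth_fun f0 by apply: smooth_funD => //; exact: smooth_fun_cst.
have vf0 : v f0 = v f.
  by rewrite tangentD ?tangent_cst ?addr0//; exact: smooth_fun_cst.
have f00 : f0 (p x0) = 0 by rewrite /f0 subrr.
have Sbf0 : smooth_fun (fun q => b q * f0 q) by exact: smooth_funM.
have <- : v (fun q => b q * (b q * f0 q)) = v f.
  by rewrite vM// vM// b1 f00 !mulr0 !mul0r !mul1r !addr0.
have -> : (fun q => b q * (b q * f0 q)) = fun q => \sum_j local_coord x0 j q * H j q.
  apply/funext => q.
  have [[y y2 <-]|nq] := pselect (exists2 y, `|x0 - y| < 2^-1 & p y = q); last first.
    rewrite [b q]transfer0// mul0r big1// => j _.
    by rewrite /local_coord transfer0// mul0r.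
  rewrite /b transferE// mulr1.
  have -> : f0 (p y) = \sum_j (y ord0 j - x0 ord0 j) * h j y.
    rewrite /f0; have := hadamard0 (y - x0) SF0.
    rewrite /F0 subrK add0r => ->; rewrite addrAC subrr add0r.
    by apply: eq_bigr => j _; rewrite !mxE.
  rewrite !mulr_sumr; apply: eq_bigr => j _.
  by rewrite /local_coord /H !transferE//; ring.
rewrite tangent_sum => [|j]; last by apply: smooth_funM => //; exact: smooth_local_coord.
apply: eq_bigr => j _; rewrite vM//; last exact: smooth_local_coord.
have -> : local_coord x0 j (p x0) = 0.
  by rewrite /local_coord transferE// !subrr mulr0.
rewrite mul0r add0r mulrC; congr (_ * _).
rewrite /H transferE// subrr bump1 ?normr0// mul1r /h subrr /ray_integral.
under eq_fun do rewrite expr0 mul1r scaler0.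
rewrite int01_cst.
have : is_derive (0 : 'rV[R]_n) 'e_j (fun z => (f \o p) (z *m 1%:M + x0))
    ('D_'e_j (f \o p) x0).
  apply: is_derive_affine; rewrite mul0mx add0r mulmx1.
  exact/derivableP/(@class_C_derivable _ _ 0).
by under eq_fun do rewrite mulmx1; move=> /@derive_val.
Qed.

End Tangent.

Definition components (X : (M -> R) -> M -> R) (x : 'rV[R]_n) : 'rV[R]_n :=
  \row_j X (local_coord x j) (p x).

Lemma vector_fieldE X f x : vector_field X -> smooth_fun f ->
  X f (p x) = 'D_(components X x) (f \o p) x.
Proof.
move=> [tX _] Sf; rewrite derive_dir; last exact: (cover_smooth cov f).1.
rewrite (tangent_vectorE (tX (p x)))//.
by apply: eq_bigr => j _; rewrite mxE.
Qed.

(** [components X y] uses the coordinates centred at [y], which move with [y]. Near [x] those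
    centred at [x] give the same values, and being fixed functions they yield the smoothness of the
    components and the bracket formula. *)
Lemma components_local X x y j : vector_field X -> `|x - y| < 8^-1 ->
  X (local_coord x j) (p y) = components X y ord0 j.
Proof.
move=> vX xy; rewrite vector_fieldE//; last exact: smooth_local_coord.
by rewrite partial_local_coord.
Qed.

Lemma smooth_components X j : vector_field X ->
  smooth_on setT (fun x => components X x ord0 j).
Proof.
move=> vX k; apply: class_C_local => x _.
exists (ball x 8^-1), (X (local_coord x j) \o p); split.
- exact: ball_open.
- by apply: ballxx; rewrite invr_gt0.
- apply: class_CT; apply: (cover_smooth cov _).1; apply: vX.2.
  exact: smooth_local_coord.
- move=> y; rewrite inE -ball_normE /ball_/= => xy.
  by rewrite components_local.
Qed.

Lemma components_bracket X Y x j : vector_field X -> vector_field Y ->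
  fields_commute X Y ->
  'D_(components X x) (fun y => components Y y ord0 j) x =
  'D_(components Y x) (fun y => components X y ord0 j) x.
Proof.
move=> vX vY XY.
have H Z W : vector_field Z -> vector_field W ->
    Z (W (local_coord x j)) (p x) =
    'D_(components Z x) (fun y => components W y ord0 j) x.
  move=> vZ vW; rewrite vector_fieldE//; last first.
    by apply: vW.2; exact: smooth_local_coord.
  apply: near_eq_derive; apply/nbhs_ballP; exists 8^-1 => /=; first by rewrite invr_gt0.
  by move=> y; rewrite -ball_normE /ball_/= => xy; exact: components_local.
rewrite -!H//; apply/eqP; rewrite -subr_eq0; apply/eqP.
by apply: XY; exact: smooth_local_coord.
Qed.

(** The lift of a function on [M] is invariant under [g], so the chain rule carries the components
    at [x] to those at [g x]; as vectors are rows, the linear part acts on the right. *)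
Lemma components_equivariant X g L v x : vector_field X -> G g ->
  g = (fun x => x *m L + v) -> components X (g x) = components X x *m L.
Proof.
move=> vX Gg gE; apply/rowP => j; rewrite mxE.
have pg z : p (g z) = p z by apply/esym/(cover_orbit cov); exists g.
rewrite pg vector_fieldE//; last exact: smooth_local_coord.
have -> : local_coord (g x) j \o p =
    fun z => (local_coord (g x) j \o p) (z *m L + v).
  by apply/funext => z; rewrite -[z *m L + v]/((fun x => x *m L + v) z) -gE /= pg.
have S := (cover_smooth cov _).1 (smooth_local_coord (g x) j).
have /@derive_val -> : is_derive x (components X x)
    (fun z => (local_coord (g x) j \o p) (z *m L + v))
    ('D_(components X x *m L) (local_coord (g x) j \o p) (g x)).
  apply: is_derive_affine; rewrite {3}gE; exact/derivableP/derivable_dir.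
by rewrite partial_local_coord// subrr normr0 invr_gt0.
Qed.

Definition frame k (X : 'I_k -> (M -> R) -> M -> R) (x : 'rV[R]_n) : 'M[R]_(k, n) :=
  \matrix_i components (X i) x.

Lemma row_free_frame k (X : 'I_k -> (M -> R) -> M -> R) x :
  (forall i, vector_field (X i)) -> independent_at (p x) X ->
  row_free (frame X x).
Proof.
move=> vX indX; rewrite -kermx_eq0; apply/rowV0P => a /sub_kermxP aV.
apply/rowP => i; rewrite mxE; move: i; apply: indX => f Sf.
have C1 : class_C 1%N setT (f \o p) by exact: (cover_smooth cov f).1.
transitivity ('D_(a *m frame X x) (f \o p) x); last by rewrite aV derive0.
rewrite derive_dir//.
under [RHS]eq_bigr do rewrite mxE mulr_suml.
rewrite exchange_big; apply: eq_bigr => i _/=.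
rewrite vector_fieldE// derive_dir// mulr_sumr.
by apply: eq_bigr => j _; rewrite !mxE mulrA.
Qed.

Lemma has_commuting_fields_dim k : has_commuting_fields M k -> (k <= n)%N.
Proof.
move=> [X [vX _ indX]].
have /eqP <- := row_free_frame vX (indX (p 0)).
exact: rank_leq_col.
Qed.

End FlatCover.

(** * Quotients by flat groups *)

Section FlatManifold.
Context {R : realType} (n : nat).

(** These conditions replace proper discontinuity: the uniform Lipschitz constant and the minimal
    displacement 1 of [fg_free] give the Hausdorff property and charts on balls of radius 1/2. *)
Record flat_group := FlatGroup {
  fg_maps :> ('rV[R]_n -> 'rV[R]_n) -> Prop;
  fg_id : fg_maps id;
  fg_comp : forall g h, fg_maps g -> fg_maps h -> fg_maps (g \o h);
  fg_inv : forall g, fg_maps g -> exists2 h, fg_maps h & cancel g h;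
  fg_affine : forall g, fg_maps g -> exists L v, g = fun x => x *m L + v;
  fg_lipschitz : exists2 K, 0 < K &
    forall g, fg_maps g -> forall x y, `|g x - g y| <= K * `|x - y|;
  fg_free : forall g x, fg_maps g -> `|g x - x| < 1 -> g = id;
  fg_cocompact : exists2 A : set 'rV[R]_n, compact A &
    forall x, exists2 g, fg_maps g & A (g x) }.

Variable G : flat_group.

Definition orbit_rel : rel 'rV[R]_n :=
  fun x y => `[< exists2 g, G g & y = g x >].

Lemma orbit_relP x y : reflect (exists2 g, G g & y = g x) (orbit_rel x y).
Proof. exact: asboolP. Qed.

Lemma orbit_rel_refl : reflexive orbit_rel.
Proof. by move=> x; apply/orbit_relP; exists id => //; exact: fg_id. Qed.

Lemma orbit_rel_sym : symmetric orbit_rel.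
Proof.
suff H x y : orbit_rel x y -> orbit_rel y x by move=> x y; apply/idP/idP; exact: H.
move=> /orbit_relP[g Gg ->]; have [h Gh gh] := fg_inv Gg.
by apply/orbit_relP; exists h => //; rewrite gh.
Qed.

Lemma orbit_rel_trans : transitive orbit_rel.
Proof.
move=> y x z /orbit_relP[g Gg ->] /orbit_relP[h Gh ->].
by apply/orbit_relP; exists (h \o g) => //; exact: fg_comp.
Qed.

Definition orbit_equiv := EquivRel orbit_rel orbit_rel_refl orbit_rel_sym
  orbit_rel_trans.

Definition orbit_space : topologicalType :=
  quotient_topology {eq_quot orbit_equiv}%qT.

Definition orbit_proj (x : 'rV[R]_n) : orbit_space := (\pi_{eq_quot orbit_equiv} x)%qT.

Lemma orbit_projP x y : orbit_proj x = orbit_proj y <-> exists2 g, G g & y = g x.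
Proof.
split=> [/eqquotP|H]; first exact: orbit_relP.
by apply/eqquotP; exact/orbit_relP.
Qed.

Lemma orbit_proj_surj q : exists x, orbit_proj x = q.
Proof. by exists (repr (q : {eq_quot orbit_equiv}%qT)); exact: reprK. Qed.

Lemma orbit_proj_continuous : continuous orbit_proj.
Proof. exact: pi_continuous. Qed.

Lemma fg_continuous g : G g -> continuous g.
Proof. by move=> /fg_affine[L [v ->]]; exact: affine_continuous. Qed.

Lemma orbit_proj_open (U : set 'rV[R]_n) : open U -> open (orbit_proj @` U).
Proof.
move=> oU.
suff : open (orbit_proj @^-1` (orbit_proj @` U)) by [].
rewrite (_ : _ @^-1` _ = \bigcup_(g in fg_maps G) g @^-1` U).
  apply: bigcup_open => g Gg; apply: open_comp => // x _.
  exact: fg_continuous.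
apply/seteqP; split=> x /=.
  by move=> [y Uy /esym/orbit_projP[g Gg yE]]; exists g => //=; rewrite -yE.
move=> [g Gg Ugx]; exists (g x) => //.
by apply/esym/orbit_projP; exists g.
Qed.

(** Otherwise the orbit of [x] comes arbitrarily close to [y]. Take [g1 x] within 1/4 of [y] and
    [g2 x] at most half as far from [y]: then [g2] composed with the inverse of [g1] moves [g1 x] by
    less than 1, hence is the identity, so [g2 x = g1 x], a contradiction. *)
Lemma orbit_sep x y : orbit_proj x <> orbit_proj y ->
  exists2 d, 0 < d & forall g x' y', G g -> `|x - x'| < d -> `|y - y'| < d ->
    y' <> g x'.
Proof.
move=> xy; apply: contrapT => H.
have {}H d : 0 < d -> exists g, exists x' y', [/\ G g, `|x - x'| < d, `|y - y'| < d & y' = g x'].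
  move=> d0; apply: contrapT => N; apply: H; exists d => // g x' y' Gg xx' yy' E.
  by apply: N; exists g, x', y'.
have [K K0 HK] := fg_lipschitz G.
have K1 : 0 < K + 1 by rewrite ltr_wpDl// ltW.
have {}H d : 0 < d -> exists2 g, G g & `|g x - y| <= (K + 1) * d.
  move=> d0; have [g [x' [y' [Gg xx' yy' E]]]] := H d d0; exists g => //.
  rewrite -(subrKA y') (le_trans (ler_normD _ _))// mulrDl mul1r lerD//.
    by rewrite E (le_trans (HK _ Gg _ _))// ler_wpM2l// ltW.
  by rewrite distrC ltW.
have [g1 Gg1 H1] : exists2 g, G g & `|g x - y| <= 4^-1.
  have [|g Gg] := H (4^-1 / (K + 1)); first by rewrite divr_gt0.
  by rewrite mulrC divfK ?gt_eqF// => ?; exists g.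
have d0 : 0 < `|g1 x - y|.
  rewrite normr_gt0 subr_eq0; apply/eqP => E; apply: xy.
  by apply/orbit_projP; exists g1.
have [g2 Gg2 H2] : exists2 g, G g &
    `|g x - y| <= Num.min 4^-1 (`|g1 x - y| / 2).
  have [|g Gg] := H (Num.min 4^-1 (`|g1 x - y| / 2) / (K + 1)).
    by rewrite divr_gt0// lt_min invr_gt0 ltr0n divr_gt0.
  by rewrite mulrC divfK ?gt_eqF// => ?; exists g.
move: H2; rewrite le_min => /andP[H2 H2'].
have [h1 Gh1 gh1] := fg_inv Gg1.
have E : g2 \o h1 = id.
  apply: (@fg_free G _ (g1 x)); first exact: fg_comp.
  rewrite /= gh1 -(subrKA y) (le_lt_trans (ler_normD _ _))//.
  by rewrite (distrC y); clear xy; lra.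
have E2 : g2 x = g1 x by rewrite -[in LHS](gh1 x) -[LHS]/((g2 \o h1) (g1 x)) E.
by rewrite E2 in H2'; clear xy; lra.
Qed.

Lemma orbit_space_hausdorff : hausdorff_space orbit_space.
Proof.
rewrite open_hausdorff => p q /eqP.
have [x <-] := orbit_proj_surj p; have [y <-] := orbit_proj_surj q => xy.
have [d d0 H] := orbit_sep xy.
exists (orbit_proj @` ball x d, orbit_proj @` ball y d) => /=.
  by rewrite !inE; split; [exists x|exists y] => //; exact: ballxx.
split; try by apply: orbit_proj_open; exact: ball_open.
apply/eqP; rewrite -subset0 => r [[x' xx' <-] [y' yy' /esym/orbit_projP[g Gg E]]].
rewrite -ball_normE /ball_/= in xx'; rewrite -ball_normE /ball_/= in yy'.
exact: (H g x' y').
Qed.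

Lemma rat_approx (x : 'rV[R]_n) e : 0 < e ->
  exists q : 'rV[rat]_n, `|x - map_mx ratr q| < e.
Proof.
move=> e0.
have H j : {q : rat | `|x ord0 j - ratr q| < e}.
  apply/cid.
  have /rat_in_itvoo[q] : x ord0 j - e < x ord0 j + e by lra.
  by rewrite in_itv/= => /andP[? ?]; exists q; rewrite ltr_distlC; apply/andP; split.
exists (\row_j sval (H j)); apply: norm_lt_coord => // j.
by rewrite !mxE; exact: svalP (H j).
Qed.

Lemma orbit_space_second_countable : @second_countable orbit_space.
Proof.
pose B (q : 'rV[rat]_n * nat) : set orbit_space :=
  orbit_proj @` ball (map_mx ratr q.1 : 'rV[R]_n) q.2.+1%:R^-1.
exists (range B); first exact: (sub_countable (card_image_le _ _) (countableP _)).
split=> [_ [q _ <-]|p U].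
  by apply: orbit_proj_open; exact: ball_open.
have [x <-] := orbit_proj_surj p => /orbit_proj_continuous/nbhs_ballP[e /= e0 He].
have [|m] := @ltr_add_invr R 0 (e / 2); first by rewrite divr_gt0.
rewrite add0r => me.
have [|q qx] := @rat_approx x m.+1%:R^-1; first by [].
exists (B (q, m)).
  split; first by exists (q, m).
  by exists x => //=; rewrite -ball_normE /ball_/= distrC.
move=> _ [z /= qz <-]; apply: He; rewrite -ball_normE /ball_/=.
rewrite -ball_normE /ball_/= in qz.
rewrite -(subrKA (map_mx ratr q)) (le_lt_trans (ler_normD _ _))//.
by rewrite (splitr e) ltrD// (lt_trans _ me).
Qed.

Lemma orbit_space_compact : compact [set: orbit_space].
Proof.
have [A cA HA] := fg_cocompact G.
rewrite (_ : setT = orbit_proj @` A).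
  apply: continuous_compact => //; apply: continuous_subspaceT.
  exact: orbit_proj_continuous.
apply/seteqP; split => // q _; have [x <-] := orbit_proj_surj q.
have [g Gg Agx] := HA x; exists (g x) => //.
by apply/esym/orbit_projP; exists g.
Qed.

Lemma orbit_proj_inj a x y : `|a - x| < 2^-1 -> `|a - y| < 2^-1 ->
  orbit_proj x = orbit_proj y -> x = y.
Proof.
move=> x2 y2 /orbit_projP[g Gg yE]; rewrite yE (fg_free Gg (x := x))//.
rewrite -yE -(subrKA a) addrC (splitr 1) (le_lt_trans (ler_normD _ _))//.
by rewrite ltrD// mul1r// distrC.
Qed.

Definition ball_chart (a : 'rV[R]_n) : chart R orbit_space n :=
  Chart (orbit_proj @` ball a 2^-1)
    (fun q => xget a [set y | ball a 2^-1 y /\ orbit_proj y = q])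
    orbit_proj.

Lemma ball_chart_map a x : ball a 2^-1 x ->
  chart_map (ball_chart a) (orbit_proj x) = x.
Proof.
move=> ax /=; case: xgetP => [y _ [ay yx]|/(_ x)]; last by case.
by move: ax ay; rewrite -ball_normE /ball_/= => ax ay; exact: (orbit_proj_inj ay ax).
Qed.

Lemma ball_chart_cod a : chart_cod (ball_chart a) = ball a 2^-1.
Proof.
apply/seteqP; split=> x.
  by move=> [_ [y ay <-] <-]; rewrite ball_chart_map.
by move=> ax; exists (orbit_proj x); [exists x|exact: ball_chart_map].
Qed.

Definition orbit_manifold : atlas_space R n :=
  @AtlasSpace R n orbit_space (range ball_chart).

Lemma is_chart_ball_chart a : is_chart (ball_chart a).
Proof.
split.
- by apply: orbit_proj_open; exact: ball_open.
- by rewrite ball_chart_cod; exact: ball_open.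
- by move=> _ [x ax <-]; rewrite ball_chart_map.
(* [chart_map] inverts [orbit_proj] on the ball, so its continuity is the openness of
   [orbit_proj]. *)
- move=> _ [x ax <-] U; rewrite ball_chart_map// => /= Ux.
  have : nbhs x (U `&` ball a 2^-1).
    by apply: filterI => //; apply: open_nbhs_nbhs; split => //; exact: ball_open.
  rewrite nbhsE => -[V [oV Vx] VU].
  apply: (@filterS _ _ _ (orbit_proj @` V)).
    move=> _ [y Vy <-]; have [Uy ay] := VU _ Vy.
    by rewrite -[_ (orbit_proj y)]/(U (chart_map (ball_chart a) (orbit_proj y)))
      ball_chart_map.
  apply: (@open_nbhs_nbhs orbit_space (orbit_proj x)).
  by split; [exact: orbit_proj_open|exists x].
- by move=> x _; exact: orbit_proj_continuous.
Qed.

(** Transition maps are vector valued, whereas [class_C_affine] treats real functions; here all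
    partial derivatives are constant. *)
Lemma class_C_affine_map k (L : 'M[R]_n) v :
  class_C k setT (fun x : 'rV[R]_n => x *m L + v).
Proof.
have D (x w : 'rV[R]_n) : is_derive x w (fun x => x *m L + v) (w *m L).
  apply/is_deriveP; apply: (@cvg_trans _ (w *m L @[_ --> 0^'])); last exact: cvg_cst.
  apply: near_eq_cvg; near=> h.
  rewrite mulmxDl -[X in X - _]addrA addrK -scalemxAl scalerA mulVf ?scale1r//.
  by near: h; exact: nbhs_dnbhs_neq.
case: k => [|k]; (split; first by move=> x _; exact: affine_continuous) => // i.
split=> [x _|]; first by have [] := D x 'e_i.
apply: (@eq_class_C _ _ _ _ _ (fun=> 'e_i *m L)) => [x|]; last exact: class_C_cst.
by have /@derive_val := D x 'e_i.
Unshelve. all: by end_near. Qed.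

(** Around each point of the overlap the transition map coincides with a single element of the
    group. *)
Lemma transition_smooth_ball_chart a b :
  transition_smooth (ball_chart a) (ball_chart b).
Proof.
move=> k; apply: class_C_local => _ [_ [[x ax <-] [y bay yx]] <-].
rewrite ball_chart_map//; have /orbit_projP[g Gg yE] := esym yx.
exists (g @^-1` ball b 2^-1), g; split.
- by apply: open_comp => [z _|]; [exact: fg_continuous|exact: ball_open].
- by rewrite /= -yE.
- by have [L [v ->]] := fg_affine Gg; exact/class_CT/class_C_affine_map.
- move=> z; rewrite inE/= => bgz.
  have -> : orbit_proj z = orbit_proj (g z) by apply/orbit_projP; exists g.
  exact: ball_chart_map.
Qed.

Lemma closed_orbit_manifold : closed_manifold orbit_manifold.
Proof.
split; last exact: orbit_space_compact.
split.
- exact: orbit_space_hausdorff.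
- exact: orbit_space_second_countable.
- by move=> _ [a _ <-]; exact: is_chart_ball_chart.
- move=> q; have [x <-] := orbit_proj_surj q.
  by exists (ball_chart x); [exists x|exists x => //; exact: ballxx].
- by move=> _ _ [a _ <-] [b _ <-]; exact: transition_smooth_ball_chart.
Qed.

Lemma flat_cover_orbit_manifold : flat_cover (M := orbit_manifold) orbit_proj (fg_maps G).
Proof.
split.
- exact: orbit_proj_surj.
- exact: orbit_projP.
- exact: fg_affine.
- exact: fg_lipschitz.
- exact: fg_free.
- move=> f; split=> [Sf k|Sf c [a _ <-] k]; last exact: class_CT.
  apply: class_C_local => x _; exists (ball x 2^-1), (f \o orbit_proj).
  split => //; [exact: ball_open|by apply: ballxx|].
  rewrite -ball_chart_cod; apply: (Sf (ball_chart x)).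
  by exists x.
Qed.

End FlatManifold.

(** * Closed forms dual to a commuting frame *)

Section DevelopingMap.
Context {R : realType} (n : nat).
Variables (M : atlas_space R n) (p : 'rV[R]_n -> M).
Variable G : set ('rV[R]_n -> 'rV[R]_n).
Hypothesis cov : flat_cover p G.

Lemma smooth_det m (A : 'rV[R]_n -> 'M[R]_m) :
  (forall i j, smooth_on setT (fun x => A x i j)) ->
  smooth_on setT (fun x => \det (A x)).
Proof.
move=> SA k; rewrite /determinant; apply: class_C_sum => s _.
apply: class_CM; first exact: class_C_cst.
by apply: class_C_prod => i _; exact: SA.
Qed.

(** Cramer's rule: the entries are cofactors divided by a determinant that never vanishes. *)
Lemma smooth_invmx m (A : 'rV[R]_n -> 'M[R]_m) i j :
  (forall x, A x \in unitmx) ->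
  (forall i j, smooth_on setT (fun x => A x i j)) ->
  smooth_on setT (fun x => invmx (A x) i j).
Proof.
move=> uA SA k.
apply: (@eq_class_C _ _ _ _ _
  (fun x => (\det (A x))^-1 * cofactor (A x) j i)) => [x|].
  by rewrite /invmx uA !mxE.
apply: class_CM.
  apply: class_CV => [x|]; first by rewrite -unitfE -unitmxE.
  exact: smooth_det.
apply: class_CM; first exact: class_C_cst.
apply: smooth_det => {}i' j' l.
by apply: (@eq_class_C _ _ _ _ _ (fun x => A x (lift j i') (lift i j'))) => [x|];
  [rewrite !mxE|exact: SA].
Qed.

(* The 1-forms dual to a frame of commuting fields are closed, hence exact on
   the cover. *)
Lemma developing_map : has_commuting_fields M n ->
  exists F : 'I_n -> 'rV[R]_n -> R, [/\ forall l, smooth_on setT (F l),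
    forall x, (\matrix_(j, l) 'D_'e_j (F l) x) \in unitmx &
    forall g, G g -> forall l x, F l (g x) = F l x + (F l (g 0) - F l 0)].
Proof.
move=> [X [vX XX indX]].
pose V := frame (M := M) p X.
have uV x : V x \in unitmx by rewrite -row_free_unit; exact: (row_free_frame cov).
have SV i j : smooth_on setT (fun x => V x i j).
  move=> k; apply: (@eq_class_C _ _ _ _ _ (fun x => components p (X i) x ord0 j)).
    by move=> x; rewrite !mxE.
  exact: (smooth_components cov).
pose W x := invmx (V x).
have SW j l : smooth_on setT (fun x => W x j l) by exact: smooth_invmx.
pose dV m x : 'M[R]_n := \matrix_(i, j) 'D_'e_m (fun y => V y i j) x.
pose dW m x : 'M[R]_n := \matrix_(i, j) 'D_'e_m (fun y => W y i j) x.
have derV i j x m : derivable (fun y => V y i j) x 'e_m.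
  exact: (@class_C_derivable _ _ 0 _ _ _ (SV i j 1%N)).
have derW i j x m : derivable (fun y => W y i j) x 'e_m.
  exact: (@class_C_derivable _ _ 0 _ _ _ (SW i j 1%N)).
have dVW m x : V x *m dW m x = - (dV m x *m W x).
  apply/eqP; rewrite -subr_eq0 opprK; apply/eqP/matrixP => i l.
  have : is_derive x 'e_m (fun y => (V y *m W y) i l)
     (\sum_j (V x i j * 'D_'e_m (fun y => W y j l) x +
        W x j l * 'D_'e_m (fun y => V y i j) x)).
    rewrite (_ : (fun y => _) = \sum_j ((fun y => V y i j) * (fun y => W y j l))).
      by apply: is_derive_sum => j; apply: is_deriveM; exact: derivableP.
    by apply/funext => y; rewrite mxE fct_sumE.
  rewrite (_ : (fun y => _) = cst ((1%:M : 'M[R]_n) i l)); last first.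
    by apply/funext => y; rewrite mulmxV.
  move=> /@derive_val; rewrite derive_cst => E.
  rewrite [RHS]mxE E !mxE -big_split; apply: eq_bigr => j _ /=.
  by rewrite !mxE [X in _ = _ + X]mulrC.
have bracket a b x : \sum_m V x a m *: row b (dV m x) =
    \sum_m V x b m *: row a (dV m x).
  apply/rowP => j; rewrite !summxE.
  have := components_bracket cov x j (vX a) (vX b) (XX a b).
  have H c d : 'D_(components p (X c) x) (fun y => components p (X d) y ord0 j) x =
      \sum_m (V x c m *: row d (dV m x)) ord0 j.
    rewrite derive_dir; last exact: (smooth_components cov).
    apply: eq_bigr => m _; rewrite !mxE; congr (_ * _).
    by congr ('D_ _ _ _); apply/funext => y; rewrite !mxE.
  by rewrite !H.
have closedW l i j x : 'D_'e_i (fun y => W y j l) x = 'D_'e_j (fun y => W y i l) x.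
  (* [B] is the exterior derivative of the [l]-th dual form, and [V B V^T] evaluates it on pairs of
     frame fields. The form is constant on the frame, so this is minus its value on the brackets,
     which vanish. *)
  pose B : 'M[R]_n := \matrix_(i, j) (dW i x j l - dW j x i l).
  suff : B = 0.
    by move=> /matrixP/(_ i j); rewrite !mxE => /eqP; rewrite subr_eq0 => /eqP.
  have VBV : V x *m B *m (V x)^T = 0.
    apply/matrixP => a b; rewrite [RHS]mxE.
    have S c d : \sum_m \sum_j V x c m * dW m x j l * V x d j =
        - ((\sum_m V x c m *: row d (dV m x)) *m W x) ord0 l.
      rewrite mulmx_suml summxE -sumrN; apply: eq_bigr => m _.
      rewrite -scalemxAl -row_mul -[dV m x *m _]opprK -dVW !mxE.
      rewrite mulrN opprK mulr_sumr; apply: eq_bigr => k _.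
      by rewrite !mxE; ring.
    transitivity (\sum_m \sum_j V x a m * dW m x j l * V x b j -
                  \sum_m \sum_j V x b m * dW m x j l * V x a j).
      rewrite mxE; under eq_bigr do rewrite mxE mulr_suml.
      rewrite exchange_big [X in _ - X]exchange_big -sumrB.
      apply: eq_bigr => m _; rewrite -sumrB; apply: eq_bigr => j' _.
      by rewrite !mxE; ring.
    by rewrite !S bracket subrr.
  have uVT : (V x)^T \in unitmx by rewrite unitmx_tr.
  rewrite -[B](mulKmx (uV x)) -[V x *m B](mulmxK uVT) VBV.
  by rewrite mul0mx mulmx0.
have /choice[F HF] : forall l, exists f, smooth_on setT f /\
    forall j x, 'D_'e_j f x = W x j l.
  move=> l; have [f Sf fW] := poincare (fun j => SW j l) (fun i j => closedW l i j).
  by exists f.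
exists F; split => [l|x|g Gg l x]; first exact: (HF l).1.
  rewrite (_ : \matrix_(_, _) _ = W x) ?unitmx_inv//.
  by apply/matrixP => j l; rewrite mxE (HF l).2.
have [L [v gE]] := cover_affine cov Gg.
(* The frame is equivariant, so the dual forms are invariant; hence the difference [H] of [F l] and
   its translate by [g] has zero gradient. *)
have LW y : L *m W (g y) = W y.
  have Vg : V (g y) = V y *m L.
    apply/row_matrixP => i; rewrite row_mul !rowK.
    exact: (components_equivariant cov y (vX i) Gg gE).
  by rewrite -[LHS](mulKmx (uV y)) [V y *m _]mulmxA -Vg mulmxV// mulmx1.
have C1 : class_C 1%N setT (F l) by exact: (HF l).1.
pose H y := F l (y *m L + v) - F l y.
have CH : class_C 1%N setT H by apply: class_CB; [exact: class_C_affine|exact: C1].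
have dH z j : 'D_'e_j H z = 0.
  have d1 := @is_derive_affine _ _ _ (F l) L v z 'e_j _ (is_derive_dir _ _ C1).
  have d2 := is_derive_dir z 'e_j C1.
  have /@derive_val -> := is_deriveB d1 d2.
  rewrite -[X in _ - X]derive_dir// [X in _ - X](HF l).2 -(LW z) mxE.
  apply/eqP; rewrite subr_eq0; apply/eqP; apply: eq_bigr => k _.
  by rewrite (HF l).2 -rowE mxE gE.
have := gradient0_cst x 0 CH dH; rewrite /H gE => E.
by rewrite -E subrKC.
Qed.

(** By invariance, the maximum over [A], which meets every orbit, is a maximum over the whole
    space. *)
Lemma invariant_critical_point (f : 'rV[R]_n -> R) (A : set 'rV[R]_n) :
  compact A -> (forall x, exists2 g, G g & A (g x)) ->
  class_C 1%N setT f -> (forall g, G g -> forall x, f (g x) = f x) ->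
  exists x, forall j, 'D_'e_j f x = 0.
Proof.
move=> cA HA Cf fG.
have A0 : A !=set0 by have [g _ Ag0] := HA 0; exists (g 0).
have [x _ xmax] := EVT_max_rV A0 cA (continuous_subspaceT (class_C_continuous Cf)).
have {}xmax y : f y <= f x.
  by have [g Gg Agy] := HA y; rewrite -(fG _ Gg); apply: xmax; rewrite inE.
exists x => j.
pose u (t : R) := f (t *: 'e_j + x).
have du (t : R) : is_derive t 1 u ('D_'e_j f (t *: 'e_j + x)).
  by apply: is_derive_line; exact/derivableP/(@class_C_derivable _ _ 0).
have : is_derive (0 : R) 1 u 0.
  apply: (@derive1_at_max _ u (-1) 1 0).
  - by rewrite (le_trans (lerN10 _)).
  - by move=> t _; have [] := du t.
  - by rewrite in_itv/= ltrN10 ltr01.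
  - by move=> t _; rewrite /u scale0r add0r.
move=> /@derive_val; have /@derive_val -> := du 0.
by rewrite scale0r add0r.
Qed.

End DevelopingMap.

(** * Mapping tori *)

Section MappingTorus.
Context {R : realType} (n N : nat) (L : 'M[int]_n.+2).
Hypothesis N_gt0 : (0 < N)%N.
Hypothesis L_last : forall w : 'rV_n.+2, (w *m L) ord0 ord_max = w ord0 ord_max.
Hypothesis L_order : L ^+ N = 1.
Hypothesis L_trace : forall w : 'rV_n.+2, w ord0 ord_max = 0 ->
  \sum_(i < N) w *m L ^+ i = 0.

Local Notation vecR w := (map_mx intr w : 'rV[R]_n.+2).
Local Notation LR := (map_mx intr L : 'M[R]_n.+2).

(** The exponent [e] matters only modulo the order of [L], so a natural number also serves for
    negative turns, without an inverse of [L]. *)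
Definition torus_map (e : nat) (w : 'rV[int]_n.+2) (x : 'rV[R]_n.+2) :=
  x *m LR ^+ e + vecR w.

(* The deck group of the mapping torus of [L]: the last coordinate runs around
   the base circle, and each turn applies [L] to the fibre. *)
Definition torus_maps (g : 'rV[R]_n.+2 -> 'rV[R]_n.+2) : Prop :=
  exists e (w : 'rV[int]_n.+2) (z : int), e%:Z = w ord0 ord_max + N%:Z * z /\ g = torus_map e w.

Lemma LR_exp e : LR ^+ e = map_mx intr (L ^+ e) :> 'M[R]_n.+2.
Proof. by rewrite rmorphXn. Qed.

Lemma L_exp_last e (w : 'rV_n.+2) : (w *m L ^+ e) ord0 ord_max = w ord0 ord_max.
Proof.
elim: e w => [|e IH] w; first by rewrite expr0 mulmx1.
by rewrite exprSr -[_ * L]/(_ *m L) mulmxA L_last IH.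
Qed.

Lemma L_col_last e i : (L ^+ e) i ord_max = (i == ord_max)%:R.
Proof. by have := L_exp_last e 'e_i; rewrite -rowE !mxE eqxx [ord_max == _]eq_sym => ->. Qed.

Lemma LR_exp_last e (x : 'rV[R]_n.+2) :
  (x *m LR ^+ e) ord0 ord_max = x ord0 ord_max.
Proof.
rewrite LR_exp mxE (bigD1 ord_max)//= big1 => [|i /negbTE ni].
  by rewrite mxE L_col_last eqxx mulr1 addr0.
by rewrite mxE L_col_last ni mulr0.
Qed.

Lemma L_exp_eq1 e (z : int) : e%:Z = N%:Z * z -> L ^+ e = 1.
Proof.
case: z => [z|z]; first by move=> [->]; rewrite exprM L_order expr1n.
by rewrite NegzE mulrN => E; exfalso; nia.
Qed.

Lemma torus_map_comp e w e' w' :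
  torus_map e w \o torus_map e' w' = torus_map (e' + e) (w' *m L ^+ e + w).
Proof.
apply/funext => x; rewrite /torus_map /= mulmxDl -mulmxA exprD map_mxD map_mxM.
by rewrite -LR_exp addrA.
Qed.

Lemma torus_maps_id : torus_maps id.
Proof.
exists 0%N, 0, 0; rewrite !mxE mulr0; split => //.
by apply/funext => x; rewrite /torus_map expr0 mulmx1 map_mx0 addr0.
Qed.

Lemma torus_maps_comp g h : torus_maps g -> torus_maps h -> torus_maps (g \o h).
Proof.
move=> [e [w [z [E ->]]]] [e' [w' [z' [E' ->]]]].
exists (e' + e)%N, (w' *m L ^+ e + w), (z' + z); split; last exact: torus_map_comp.
by rewrite mxE L_exp_last PoszD E E'; ring.
Qed.

Lemma torus_maps_inv g : torus_maps g ->
  exists2 h, torus_maps h & cancel g h.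
Proof.
(* As [L ^+ N = 1], the inverse of [L ^+ e] is [L ^+ ((N - 1) * e)]. *)
move=> [e [w [z [E ->]]]]; pose e' := (N.-1 * e)%N.
exists (torus_map e' (- (w *m L ^+ e'))).
  exists e', (- (w *m L ^+ e')), (w ord0 ord_max + (N%:Z - 1) * z); split => //.
  rewrite mxE L_exp_last /e' PoszM E.
  have -> : N.-1%:Z = N%:Z - 1 by lia.
  by ring.
move=> x; rewrite -[LHS]/((torus_map e' _ \o torus_map e w) x) torus_map_comp.
rewrite addrN /torus_map map_mx0 addr0 LR_exp.
have -> : (e + e' = N * e)%N by rewrite /e'; case: N N_gt0 => // m _; rewrite mulSn.
by rewrite exprM L_order expr1n map_mx1 mulmx1.
Qed.

Lemma torus_maps_affine g : torus_maps g -> exists A v, g = fun x => x *m A + v.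
Proof. by move=> [e [w [z [_ ->]]]]; exists (LR ^+ e), (vecR w). Qed.

(** Only the finitely many powers [L ^+ i] with [i < N] occur as linear parts, so the sum of their
    bounds serves all maps. *)
Lemma torus_maps_lipschitz : exists2 K, 0 < K &
  forall g, torus_maps g -> forall x y, `|g x - g y| <= K * `|x - y|.
Proof.
have H i : {K | 0 < K & forall x : 'rV[R]_n.+2, `|x *m LR ^+ i| <= K * `|x|}.
  exact/cid2/mulmx_bounded.
exists (1 + \sum_(i < N) s2val (H i)) => [|_ [e [w [z [_ ->]]]] x y].
  by rewrite ltr_pwDl// sumr_ge0// => i _; case: (H i) => K /= /ltW.
rewrite /torus_map opprD addrACA subrr addr0 -mulmxBl.
have -> : LR ^+ e = LR ^+ (e %% N).
  by rewrite !LR_exp [in LHS](divn_eq e N) exprD mulnC exprM L_order expr1n mul1r.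
have eN : (e %% N < N)%N by rewrite ltn_pmod.
have := s2valP' (H (e %% N)%N) (x - y) => /le_trans; apply.
rewrite ler_wpM2r// (bigD1 (Ordinal eN))//= addrCA lerDl addr_ge0//.
by rewrite sumr_ge0// => i _; case: (H i) => K /= /ltW.
Qed.

Lemma int_norm_lt1 (z : int) : `|z%:~R : R| < 1 -> z = 0.
Proof. by rewrite -intr_norm ltrz1 => ?; lia. Qed.

(** [L] keeps the last coordinate, so the base displacement is an integer, zero if less than 1. Then
    [N] divides [e], the map is an integral translation, and all its coordinates vanish for the same
    reason. *)
Lemma torus_maps_free g x : torus_maps g -> `|g x - x| < 1 -> g = id.
Proof.
move=> [e [w [z [E ->]]]] gx.
have w_last : w ord0 ord_max = 0.
  apply: int_norm_lt1; have := le_lt_trans (coord_le_norm _ ord_max) gx.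
  by rewrite mxE [torus_map _ _ _]lock mxE -lock mxE LR_exp_last !mxE addrAC subrr add0r.
have Le : L ^+ e = 1 by apply: (L_exp_eq1 (z := z)); rewrite E w_last add0r.
have tE y : torus_map e w y = y + vecR w.
  by rewrite /torus_map LR_exp Le map_mx1 mulmx1.
have w0 : w = 0.
  apply/rowP => j; rewrite [RHS]mxE; apply: int_norm_lt1.
  have := le_lt_trans (coord_le_norm _ j) gx.
  by rewrite tE addrAC subrr add0r mxE.
by apply/funext => y; rewrite tE w0 map_mx0 addr0.
Qed.

Definition unit_cube : set 'rV[R]_n.+2 :=
  [set x | forall j, `[0%R, 1%R]%classic (x ord0 j)].

Lemma unit_cube_compact : compact unit_cube.
Proof.
apply: (@rV_compact R _ (fun=> `[0%R, 1%R]%classic)) => j.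
exact: segment_compact.
Qed.

Lemma torus_maps_cocompact x : exists2 g, torus_maps g & unit_cube (g x).
Proof.
pose f (a : R) : int := - Num.floor a.
have fP a : 0 <= a + (f a)%:~R <= 1.
  rewrite /f rmorphN/= subr_ge0 lerBlDr; apply/andP; split.
    exact: Num.Theory.ge_floor.
  by rewrite addrC ltW// -[1]/(1%:~R) -intrD Num.Theory.lt_succ_floor.
(* The base coordinate is not changed by [L ^+ e], so its shift [k] can be chosen first; it
   determines [e] modulo [N], and the fibre shifts are chosen after applying [L ^+ e]. *)
pose k := f (x ord0 ord_max).
pose e := `|(k %% N%:Z)%Z|%N.
pose w : 'rV[int]_n.+2 := \row_j f ((x *m LR ^+ e) ord0 j).
have wk : w ord0 ord_max = k by rewrite mxE LR_exp_last.
exists (torus_map e w).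
  exists e, w, (- (k %/ N%:Z)%Z); split => //.
  have N0 : N%:Z != 0 by lia.
  rewrite wk /e gez0_abs ?modz_ge0// {2}(divz_eq k N%:Z); ring.
move=> j; have := fP ((x *m LR ^+ e) ord0 j).
have -> : torus_map e w x ord0 j = (x *m LR ^+ e) ord0 j + (w ord0 j)%:~R.
  by rewrite /torus_map mxE [X in _ + X]mxE.
by rewrite /= in_itv/= [w _ _]mxE.
Qed.

Definition torus_group : flat_group n.+2 := FlatGroup torus_maps_id
  torus_maps_comp torus_maps_inv torus_maps_affine torus_maps_lipschitz
  torus_maps_free (ex_intro2 _ _ unit_cube unit_cube_compact torus_maps_cocompact).

Definition mapping_torus : atlas_space R n.+2 := orbit_manifold torus_group.

End MappingTorus.

(** * Upper bound for the rank of a mapping torus *)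

Section MappingTorusRank.
Context {R : realType} (n N : nat) (L : 'M[int]_n.+2).
Hypothesis N_gt0 : (0 < N)%N.
Hypothesis L_last : forall w : 'rV_n.+2, (w *m L) ord0 ord_max = w ord0 ord_max.
Hypothesis L_order : L ^+ N = 1.
(** Since [L ^+ N = 1], this amounts to [L] fixing no nonzero vector of the fibre. *)
Hypothesis L_trace : forall w : 'rV_n.+2, w ord0 ord_max = 0 ->
  \sum_(i < N) w *m L ^+ i = 0.

Local Notation vecR w := (map_mx intr w : 'rV[R]_n.+2).
Local Notation LR := (map_mx intr L : 'M[R]_n.+2).
Local Notation e_last := ('e_ord_max : 'rV[int]_n.+2).
Local Notation torus_maps := (@torus_maps R n N L).

Lemma torus_maps_translation (w : 'rV[int]_n.+2) : w ord0 ord_max = 0 ->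
  torus_maps (torus_map L 0 w).
Proof. by move=> w0; exists 0%N, w, 0; rewrite w0 mulr0. Qed.

Lemma torus_maps_monodromy : torus_maps (torus_map L 1 e_last).
Proof. by exists 1%N, e_last, 0; rewrite mxE !eqxx mulr0. Qed.

(* Conjugation by the monodromy turns the translation by [w] into that by
   [w *m L], so that [\sum_i w *m L ^+ i = 0] forces the period to vanish. *)
Lemma translation_period0 (f : 'rV[R]_n.+2 -> R) :
  (forall g, torus_maps g -> forall x, f (g x) = f x + (f (g 0) - f 0)) ->
  forall (w : 'rV[int]_n.+2) x, w ord0 ord_max = 0 -> f (x + vecR w) = f x.
Proof.
move=> fG; pose T w := f (vecR w) - f 0.
have fT (w : 'rV[int]_n.+2) x : w ord0 ord_max = 0 -> f (x + vecR w) = f x + T w.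
  move=> w0; have := fG _ (torus_maps_translation w0) x.
  by rewrite /torus_map !expr0 !mulmx1 add0r.
have TL (w : 'rV[int]_n.+2) : w ord0 ord_max = 0 -> T (w *m L) = T w.
  move=> w0; have := fG _ torus_maps_monodromy (vecR w).
  have := fT _ (vecR e_last) (etrans (L_last w) w0).
  rewrite /torus_map expr1 mul0mx add0r -map_mxM [vecR e_last + _]addrC => -> E.
  by move: E; rewrite /T => E; lra.
have TLi i (w : 'rV[int]_n.+2) : w ord0 ord_max = 0 -> T (w *m L ^+ i) = T w.
  elim: i w => [|i IH] w w0; first by rewrite expr0 mulmx1.
  by rewrite exprS -[L * _]/(L *m _) mulmxA IH ?TL// L_last.
have TD (w w' : 'rV[int]_n.+2) : w ord0 ord_max = 0 -> w' ord0 ord_max = 0 ->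
    T (w + w') = T w + T w'.
  move=> w0 w0'; rewrite {1}/T map_mxD fT//.
  by rewrite /T addrAC.
move=> w x w0; rewrite fT//.
suff -> : T w = 0 by rewrite addr0.
have T0 : T 0 = 0 by rewrite /T map_mx0 subrr.
have : \sum_(i < N) T (w *m L ^+ i) = 0.
  transitivity (T (\sum_(i < N) w *m L ^+ i)); last by rewrite L_trace.
  suff : T (\sum_(i < N) w *m L ^+ i) = \sum_(i < N) T (w *m L ^+ i) /\
      (\sum_(i < N) w *m L ^+ i) ord0 ord_max = 0 by case=> ->.
  elim: (index_enum _) => [|i r [IH r0]]; first by rewrite !big_nil mxE.
  rewrite !big_cons mxE r0 L_exp_last// w0; split => //.
  by rewrite TD ?IH// L_exp_last.
under eq_bigr do rewrite TLi//.
rewrite sumr_const card_ord => /eqP; rewrite mulrn_eq0 => /orP[|/eqP //].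
by rewrite -leqn0 leqNgt N_gt0.
Qed.

(** The fibre translations and one turn around the base generate the deck group. Maps with
    nonnegative base shift are reached by induction on the number of turns, the others through their
    inverses. *)
Lemma torus_invariant (f : 'rV[R]_n.+2 -> R) :
  (forall (w : 'rV[int]_n.+2) x, w ord0 ord_max = 0 -> f (x + vecR w) = f x) ->
  (forall x, f (torus_map L 1 e_last x) = f x) ->
  forall g, torus_maps g -> forall x, f (g x) = f x.
Proof.
move=> fT ft.
have step x (u : 'rV[int]_n.+2) : u ord0 ord_max = 1 -> f (x *m LR + vecR u) = f x.
  move=> u1; rewrite -[RHS]ft -[RHS](fT (u - e_last)); last first.
    by rewrite !mxE u1 !eqxx.
  by rewrite /torus_map expr1 -addrA -map_mxD subrKC.
have pow e x (w : 'rV[int]_n.+2) : w ord0 ord_max = e%:Z ->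
    f (x *m LR ^+ e + vecR w) = f x.
  elim: e w => [|e IH] w we; first by rewrite expr0 mulmx1 fT.
  pose w' : 'rV[int]_n.+2 := e%:Z *: e_last.
  have w'e : w' ord0 ord_max = e%:Z by rewrite !mxE !eqxx mulr1.
  rewrite -[RHS](IH w')// -[RHS](step _ (w - w' *m L)); last first.
    by rewrite mxE we mxE L_last w'e; lia.
  rewrite mulmxDl -mulmxA exprSr -[LR ^+ e * LR]/(LR ^+ e *m LR) -addrA.
  by rewrite -map_mxM -map_mxD subrKC.
have pos e (w : 'rV[int]_n.+2) z x : e%:Z = w ord0 ord_max + N%:Z * z ->
    0 <= w ord0 ord_max -> f (torus_map L e w x) = f x.
  move=> E w0; rewrite /torus_map.
  have -> : LR ^+ e = LR ^+ `|w ord0 ord_max|%N.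
    rewrite !LR_exp; congr map_mx.
    case: z E => [z|z] E.
      have -> : (e = `|w ord0 ord_max| + N * z)%N by nia.
      by rewrite exprD exprM L_order expr1n mulr1.
    have -> : (`|w ord0 ord_max| = e + N * z.+1)%N by nia.
    by rewrite exprD exprM L_order expr1n mulr1.
  by apply: pow; rewrite gez0_abs.
move=> g Gg x; have [e [w [z [E gE]]]] := Gg.
have [w0|w0] := leP 0 (w ord0 ord_max); first by rewrite gE (pos _ _ _ _ E).
have [h [e' [w' [z' [E' hE]]]] gh] := torus_maps_inv N_gt0 L_last L_order Gg.
rewrite -[in RHS](gh x) hE (pos _ _ _ _ E')//.
have := gh x => /(congr1 (fun y : 'rV[R]_n.+2 => y ord0 ord_max)).
rewrite hE gE /torus_map mxE LR_exp_last// mxE LR_exp_last// [vecR w _ _]mxE.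
rewrite [vecR w' _ _]mxE -addrA => /eqP.
rewrite -[X in _ == X]addr0 (inj_eq (addrI _)) -intrD intr_eq0 => /eqP; lia.
Qed.

Lemma mapping_torus_rank k :
  has_commuting_fields (mapping_torus (R := R) N_gt0 L_last L_order) k ->
  (k <= n.+1)%N.
Proof.
set M := mapping_torus _ _ _ => HM.
have cov : flat_cover (M := M) (orbit_proj (torus_group N_gt0 L_last L_order))
    torus_maps := flat_cover_orbit_manifold _.
rewrite -ltnS ltn_neqAle (has_commuting_fields_dim cov HM) andbT.
apply/eqP => kn; move: HM; rewrite kn.
move=> /(developing_map cov)[F [SF uF FG]].
have F_period l : forall (w : 'rV[int]_n.+2) x, w ord0 ord_max = 0 -> F l (x + vecR w) = F l x.
  by apply: translation_period0 => g Gg x; exact: FG.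
pose c l := F l (torus_map L 1 e_last 0) - F l 0.
have Fc l x : F l (torus_map L 1 e_last x) = F l x + c l.
  by apply: FG; exact: torus_maps_monodromy.
(* One linear condition on two unknowns. The dimension [n.+2] makes [ord0] and [ord_max] distinct
   indices. *)
have [a [b [ab abc]]] : exists a b, (a != 0) || (b != 0) /\
    a * c ord0 + b * c ord_max = 0.
  have [c0|c0] := eqVneq (c ord0) 0.
    by exists 1, 0; rewrite c0 oner_eq0 mulr0 mul0r addr0.
  by exists (- c ord_max), (c ord0); rewrite c0 orbT; split => //; ring.
pose f x := a * F ord0 x + b * F ord_max x.
have Cf : class_C 1%N setT f.
  by apply: class_CD; (apply: class_CM; [exact: class_C_cst|exact: SF]).
have fG : forall g, torus_maps g -> forall x, f (g x) = f x.
  apply: torus_invariant => [w x w0|x]; first by rewrite /f !F_period.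
  by have := abc; rewrite /f !Fc => abc'; rewrite -[RHS]addr0 -abc'; ring.
have [x x0] := invariant_critical_point (@unit_cube_compact R n)
  (torus_maps_cocompact N_gt0 L_last) Cf fG.
pose J := \matrix_(j, l) 'D_'e_j (F l) x.
(* [J *m u] is the gradient of [f] at the critical point [x]; as the Jacobian [J] is invertible, [u]
   vanishes and so do [a] and [b]. *)
pose u : 'cV[R]_n.+2 := a *: delta_mx ord0 ord0 + b *: delta_mx ord_max ord0.
have Ju : J *m u = 0.
  apply/colP => j; rewrite mulmxDr -!scalemxAr -!colE !mxE.
  rewrite -(x0 j).
  have dF l : is_derive x 'e_j (F l) ('D_'e_j (F l) x).
    exact/derivableP/(@class_C_derivable _ _ 0 (F l) j x (SF l 1%N)).
  have d1 := is_deriveD (is_deriveZ a (dF ord0)) (is_deriveZ b (dF ord_max)).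
  by have /@derive_val := d1.
have u0 : u = 0 by rewrite -[u](mulKmx (uF x)) -/J Ju mulmx0.
move: ab; have := congr1 (fun y : 'cV[R]_n.+2 => y ord0 ord0) u0.
have := congr1 (fun y : 'cV[R]_n.+2 => y ord_max ord0) u0.
rewrite !mxE !eqxx /= !mulr0 !mulr1 addr0 add0r => -> ->.
by rewrite eqxx.
Qed.

End MappingTorusRank.

(** * Products *)

Section InvariantFields.
Context {R : realType} (n : nat).
Variables (M : atlas_space R n) (p : 'rV[R]_n -> M).
Variable G : set ('rV[R]_n -> 'rV[R]_n).
Hypothesis cov : flat_cover p G.

Definition cover_lift (q : M) : 'rV[R]_n := sval (cid (cover_surj cov q)).

Lemma cover_liftK q : p (cover_lift q) = q.
Proof. exact: svalP (cid (cover_surj cov q)). Qed.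

(** The lift of [q] is an arbitrary choice, made harmless by equivariance of [a] through
    [pushforwardE]. *)
Definition pushforward (a : 'rV[R]_n -> 'rV[R]_n) (f : M -> R) (q : M) : R :=
  'D_(a (cover_lift q)) (f \o p) (cover_lift q).

Definition equivariant (a : 'rV[R]_n -> 'rV[R]_n) : Prop :=
  forall g L v x, G g -> g = (fun x => x *m L + v) -> a (g x) = a x *m L.

Lemma pushforwardE a f x : equivariant a -> smooth_fun f ->
  pushforward a f (p x) = 'D_(a x) (f \o p) x.
Proof.
move=> eqa Sf; rewrite /pushforward.
have /(cover_orbit cov)[g Gg yE] := esym (cover_liftK (p x)).
have C1 : class_C 1%N setT (f \o p) by exact: (cover_smooth cov f).1.
have [L [v gE]] := cover_affine cov Gg.
have fg : f \o p = fun z => (f \o p) (z *m L + v).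
  apply/funext => z; rewrite -[z *m L + v]/((fun x => x *m L + v) z) -gE /=.
  by congr f; apply/(cover_orbit cov); exists g.
rewrite [in RHS]fg.
have d := @is_derive_affine _ _ _ (f \o p) L v x (a x) _ (is_derive_dir _ _ C1).
have /@derive_val -> := d.
by rewrite yE (eqa _ _ _ _ Gg gE) -derive_dir// gE.
Qed.

Lemma vector_field_pushforward a : equivariant a ->
  (forall j, smooth_on setT (fun x => a x ord0 j)) -> vector_field (pushforward a).
Proof.
move=> eqa Sa; split=> [q|f Sf].
  have dF (h : M -> R) : smooth_fun h -> is_derive (cover_lift q) (a (cover_lift q)) (h \o p)
      ('D_(a (cover_lift q)) (h \o p) (cover_lift q)).
    move=> Sh; apply/derivableP/derivable_dir; exact: (cover_smooth cov h).1.
  split=> [c f g Sf Sg|f g Sf Sg].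
    by have /@derive_val := is_deriveD (is_deriveZ c (dF f Sf)) (dF g Sg).
  have /@derive_val := is_deriveM (dF f Sf) (dF g Sg).
  by rewrite /pushforward /= cover_liftK.
apply/(cover_smooth cov) => k.
have SF := (cover_smooth cov f).1 Sf.
apply: (@eq_class_C _ _ _ _ _ (fun x => \sum_j a x ord0 j * 'D_'e_j (f \o p) x)) => [x|].
  by rewrite /= pushforwardE// derive_dir//; exact: SF.
apply: class_C_sum => j _; apply: class_CM; first exact: Sa.
exact: (@class_C_partial _ _ k (f \o p) j (SF k.+1)).
Qed.

(** The coefficients of each field are constant along the other, so no first-order terms appear:
    both compositions are sums of [a_i b_j] times second partial derivatives, and [partialC]
    identifies them. *)
Lemma fields_commute_pushforward a b :
  equivariant a -> equivariant b ->
  (forall j, smooth_on setT (fun x => a x ord0 j)) ->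
  (forall j, smooth_on setT (fun x => b x ord0 j)) ->
  (forall x (h : R), a (h *: b x + x) = a x) ->
  (forall x (h : R), b (h *: a x + x) = b x) ->
  fields_commute (pushforward a) (pushforward b).
Proof.
move=> eqa eqb Sa Sb ab ba f Sf q; have [x <-] := cover_surj cov q.
have SF := (cover_smooth cov f).1 Sf; set F := f \o p in SF *.
have H c d : equivariant c -> equivariant d ->
    (forall j, smooth_on setT (fun x => c x ord0 j)) ->
    (forall j, smooth_on setT (fun x => d x ord0 j)) ->
    (forall x (h : R), d (h *: c x + x) = d x) ->
    pushforward c (pushforward d f) (p x) =
    \sum_i \sum_j c x ord0 i * d x ord0 j * 'D_'e_i (fun y => 'D_'e_j F y) x.
  move=> eqc eqd Sc Sd dc.
  have C1 j : class_C 1%N setT (fun y => 'D_'e_j F y).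
    exact: (@class_C_partial _ _ 1 F j (SF 2%N)).
  have S : smooth_fun (pushforward d f) by apply: (vector_field_pushforward eqd Sd).2.
  rewrite pushforwardE//.
  have -> : pushforward d f \o p = \sum_j ((fun y => d y ord0 j) * (fun y => 'D_'e_j F y)).
    apply/funext => y; rewrite fct_sumE /= pushforwardE//.
    by rewrite derive_dir//; exact: (SF 1%N).
  have dd j : is_derive x (c x) (fun y => d y ord0 j) 0.
    apply/is_deriveP; apply: (@cvg_trans _ ((0 : R) @[_ --> 0^'])); last exact: cvg_cst.
    by apply: near_eq_cvg; apply: nearW => h; rewrite dc subrr scaler0.
  have /@derive_val -> : is_derive x (c x)
      (\sum_j ((fun y => d y ord0 j) * (fun y => 'D_'e_j F y)))
      (\sum_j (d x ord0 j *: (\sum_i c x ord0 i * 'D_'e_i (fun y => 'D_'e_j F y) x) +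
         'D_'e_j F x *: 0)).
    by apply: is_derive_sum => j; apply: is_deriveM => //; exact: is_derive_dir.
  rewrite exchange_big; apply: eq_bigr => j _ /=.
  rewrite scaler0 addr0 /GRing.scale/= mulr_sumr; apply: eq_bigr => i _.
  by rewrite mulrA [d x ord0 j * _]mulrC.
rewrite /lie_bracket !H//; apply/eqP; rewrite subr_eq0; apply/eqP.
rewrite exchange_big; apply: eq_bigr => i _; apply: eq_bigr => j _ /=.
by rewrite partialC ?[b x ord0 i * _]mulrC//; exact: SF.
Qed.

Lemma independent_pushforward k (a : 'I_k -> 'rV[R]_n -> 'rV[R]_n) x :
  (forall i, equivariant (a i)) -> row_free (\matrix_i a i x) ->
  independent_at (p x) (fun i => pushforward (a i)).
Proof.
move=> eqa free c H.
have cA : (\row_i c i) *m (\matrix_i a i x) = 0.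
  apply/rowP => j; rewrite [RHS]mxE -[RHS](H (local_coord p x j)); last first.
    exact: (smooth_local_coord cov).
  rewrite mxE; apply: eq_bigr => i _; rewrite !mxE pushforwardE//; last first.
    exact: (smooth_local_coord cov).
  by rewrite (partial_local_coord cov)// subrr normr0 invr_gt0.
move=> i; have /rowP/(_ i) : \row_i c i = 0.
  by apply: (row_free_inj free); rewrite cA mul0mx.
by rewrite !mxE.
Qed.

End InvariantFields.

(** * The product of two flat quotients *)

Section ProductCover.
Context {R : realType} (m n : nat) (G : @flat_group R m) (H : @flat_group R n).

Definition prod_proj (v : 'rV[R]_(m + n)) :
    prod_manifold (orbit_manifold G) (orbit_manifold H) :=
  (orbit_proj G (lsubmx v), orbit_proj H (rsubmx v)).

Definition prod_maps (g : 'rV[R]_(m + n) -> 'rV[R]_(m + n)) : Prop :=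
  exists g1 g2, [/\ G g1, H g2 &
    g = fun v => row_mx (g1 (lsubmx v)) (g2 (rsubmx v))].

Lemma norm_row_mx (a : 'rV[R]_m) (b : 'rV[R]_n) M : 0 <= M ->
  `|a| <= M -> `|b| <= M -> `|row_mx a b| <= M.
Proof.
move=> M0 aM bM; apply: norm_le_coord => // j.
by rewrite mxE; case: (fintype.split j) => i; rewrite (le_trans (coord_le_norm _ _)).
Qed.

Lemma norm_lsubmx (v : 'rV[R]_(m + n)) : `|lsubmx v| <= `|v|.
Proof. by apply: norm_le_coord => // j; rewrite mxE coord_le_norm. Qed.

Lemma norm_rsubmx (v : 'rV[R]_(m + n)) : `|rsubmx v| <= `|v|.
Proof. by apply: norm_le_coord => // j; rewrite mxE coord_le_norm. Qed.

Lemma lsubmx_continuous : continuous (fun v : 'rV[R]_(m + n) => lsubmx v).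
Proof.
apply: (@lipschitz_continuous _ _ _ _ 1) => // x y.
by rewrite mul1r -linearB norm_lsubmx.
Qed.

Lemma rsubmx_continuous : continuous (fun v : 'rV[R]_(m + n) => rsubmx v).
Proof.
apply: (@lipschitz_continuous _ _ _ _ 1) => // x y.
by rewrite mul1r -linearB norm_rsubmx.
Qed.

Lemma prod_ball_chart_cod a b :
  chart_cod (prod_chart (ball_chart G a) (ball_chart H b)) =
  [set v | ball a 2^-1 (lsubmx v) /\ ball b 2^-1 (rsubmx v)].
Proof.
apply/seteqP; split=> v.
  move=> [[q r] [[x ax qE] [y yb rE]] <-].
  have {qE}-> : q = orbit_proj G x by [].
  have {rE}-> : r = orbit_proj H y by [].
  rewrite -[chart_map _ _]/(row_mx
    (chart_map (ball_chart G a) (orbit_proj G x))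
    (chart_map (ball_chart H b) (orbit_proj H y))).
  by rewrite !ball_chart_map//= row_mxKl row_mxKr.
move=> [av bv]; exists (prod_proj v); first by split; [exists (lsubmx v)|exists (rsubmx v)].
transitivity (row_mx (chart_map (ball_chart G a) (orbit_proj G (lsubmx v)))
  (chart_map (ball_chart H b) (orbit_proj H (rsubmx v)))) => //.
by rewrite !ball_chart_map// hsubmxK.
Qed.

(** In the sup norm, a displacement below 1 in the product is below 1 in each factor, so the
    constant of [cover_free] is inherited. *)
Lemma flat_cover_prod : flat_cover prod_proj prod_maps.
Proof.
split.
- move=> [q r]; have [x <-] := orbit_proj_surj q; have [y <-] := orbit_proj_surj r.
  by exists (row_mx x y); rewrite /prod_proj row_mxKl row_mxKr.
- move=> x y; split.
    move=> [/orbit_projP[g Gg xE] /orbit_projP[h Hh yE]].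
    exists (fun v => row_mx (g (lsubmx v)) (h (rsubmx v))).
      by exists g, h.
    by rewrite -xE -yE hsubmxK.
  move=> [_ [g [h [Gg Hh ->]]] ->]; rewrite /prod_proj row_mxKl row_mxKr.
  by congr pair; apply/orbit_projP; [exists g|exists h].
- move=> _ [g [h [/fg_affine[L [v ->]] /fg_affine[L' [v' ->]] ->]]].
  exists (block_mx L 0 0 L'), (row_mx v v'); apply/funext => x.
  rewrite -{3}[x]hsubmxK mul_row_block !mulmx0 addr0 add0r.
  by rewrite add_row_mx.
- have [K K0 HK] := fg_lipschitz G; have [K' K0' HK'] := fg_lipschitz H.
  exists (K + K') => [|_ [g [h [Gg Hh ->]]] x y]; first exact: addr_gt0.
  rewrite opp_row_mx add_row_mx.
  have KK : 0 <= K + K' by rewrite addr_ge0// ltW.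
  apply: norm_row_mx; first by rewrite mulr_ge0.
    rewrite (le_trans (HK _ Gg _ _))// -linearB ler_pM// ?norm_lsubmx//; last first.
      by rewrite lerDl ltW.
    exact: ltW.
  rewrite (le_trans (HK' _ Hh _ _))// -linearB ler_pM// ?norm_rsubmx//; last first.
    by rewrite lerDr ltW.
  exact: ltW.
- move=> _ x [g [h [Gg Hh ->]]] gx.
  have gE : g = id.
    apply: (fg_free Gg (x := lsubmx x)); apply: le_lt_trans gx.
    by rewrite -[X in `|X - _|](row_mxKl _ (h (rsubmx x))) -linearB norm_lsubmx.
  have hE : h = id.
    apply: (fg_free Hh (x := rsubmx x)); apply: le_lt_trans gx.
    by rewrite -[X in `|X - _|](row_mxKr (g (lsubmx x))) -linearB norm_rsubmx.
  by apply/funext => v; rewrite gE hE hsubmxK.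
- move=> f; split=> [Sf k|Sf _ [_ [_ [[a _ <-] [b _ <-] ->]]] k]; last first.
    by apply: class_CT; exact: Sf.
  apply: class_C_local => x _.
  exists [set v | ball (lsubmx x) 2^-1 (lsubmx v) /\ ball (rsubmx x) 2^-1 (rsubmx v)],
    (f \o prod_proj).
  split => //.
  + apply: openI; apply: open_comp => [v _|]; try exact: ball_open.
      exact: lsubmx_continuous.
    exact: rsubmx_continuous.
  + by split; exact: ballxx.
  + rewrite -prod_ball_chart_cod.
    apply: (Sf (prod_chart (ball_chart G (lsubmx x)) (ball_chart H (rsubmx x)))).
    exists (ball_chart G (lsubmx x)), (ball_chart H (rsubmx x)).
    by split => //; eexists.
Qed.

End ProductCover.

(** * Lower bound for the rank of the product *)

Section ProductRank.
Context {R : realType}.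

(** These are real powers of [L] that keep the base coordinate. Smoothness is stated after
    composition with [q] because [class_C] concerns functions of row vectors. *)
Record one_parameter_group (n : nat) (L : 'M[int]_n.+2)
    (Q : R -> 'M[R]_n.+2) : Prop := OneParameterGroup {
  opg0 : Q 0 = 1;
  opgD : forall s t, Q (s + t) = Q s * Q t;
  opg1 : Q 1 = map_mx intr L;
  opg_last : forall t (x : 'rV_n.+2), (x *m Q t) ord0 ord_max = x ord0 ord_max;
  opg_smooth : forall m k (q : 'rV[R]_m -> R) i j, class_C k setT q ->
    class_C k setT (fun x => Q (q x) i j) }.

Lemma opg_nat n (L : 'M[int]_n.+2) Q (e : nat) : one_parameter_group L Q ->
  Q e%:R = map_mx intr L ^+ e.
Proof.
move=> QL; elim: e => [|e IH]; first by rewrite (opg0 QL) expr0.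
by rewrite -natr1 (opgD QL) IH (opg1 QL) exprSr.
Qed.

Lemma opg_int n (L : 'M[int]_n.+2) Q (N e : nat) (z : int) :
  one_parameter_group L Q -> L ^+ N = 1 ->
  Q (e%:Z + N%:Z * z)%:~R = map_mx intr L ^+ e.
Proof.
move=> QL LN; rewrite intrD (opgD QL) -[e%:~R]/(e%:R) (opg_nat _ QL).
suff -> : Q (N%:Z * z)%:~R = 1 by rewrite mulr1.
have pos m : Q (N * m)%:R = 1.
  by rewrite (opg_nat _ QL) exprM -rmorphXn LN rmorph1 expr1n.
case: z => [m|m]; first by rewrite -PoszM; exact: pos.
rewrite NegzE mulrN -PoszM rmorphN /= -[LHS]mul1r -[X in X * _](pos m.+1) -(opgD QL).
by rewrite subrr (opg0 QL).
Qed.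

Lemma opg_unit n (L : 'M[int]_n.+2) Q t : one_parameter_group L Q ->
  Q t * Q (- t) = 1.
Proof. by move=> QL; rewrite -(opgD QL) subrr (opg0 QL). Qed.

(** [equivariant] quantifies over every affine expression of a deck map, so its linear part has to
    be identified. *)
Lemma affine_linear_part n (L L' : 'M[R]_n) v v' :
  (fun x : 'rV[R]_n => x *m L + v) = (fun x => x *m L' + v') -> L = L'.
Proof.
move=> E; have E0 := congr1 (fun f => f 0) E.
rewrite /= !mul0mx !add0r in E0.
apply/row_matrixP => i; rewrite !rowE.
by have := congr1 (fun f => f 'e_i) E; rewrite /= E0 => /addIr.
Qed.

Variables (n1 n2 N1 N2 : nat) (L1 : 'M[int]_n1.+2) (L2 : 'M[int]_n2.+2).
Hypotheses (N1_gt0 : (0 < N1)%N) (N2_gt0 : (0 < N2)%N).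
Hypothesis L1_last : forall w : 'rV_n1.+2, (w *m L1) ord0 ord_max = w ord0 ord_max.
Hypothesis L2_last : forall w : 'rV_n2.+2, (w *m L2) ord0 ord_max = w ord0 ord_max.
Hypotheses (L1_order : L1 ^+ N1 = 1) (L2_order : L2 ^+ N2 = 1).
Variables (Q1 : R -> 'M[R]_n1.+2) (Q2 : R -> 'M[R]_n2.+2).
Hypothesis Q1L : one_parameter_group L1 Q1.
Hypothesis Q2L : one_parameter_group L2 Q2.
(** Base shifts [s1], [s2] change [theta] by [N2 s1 - N1 s2]. Its multiple by [l1] is [s1] modulo
    [N1], and its multiple by [l2] is [s2] modulo [N2]. *)
Variables (l1 l2 b1 b2 : int).
Hypothesis bezout1 : l1 * N2%:Z = 1 + N1%:Z * b1.
Hypothesis bezout2 : l2 * N1%:Z = - 1 + N2%:Z * b2.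

Local Notation G1 := (torus_group (R := R) N1_gt0 L1_last L1_order).
Local Notation G2 := (torus_group (R := R) N2_gt0 L2_last L2_order).
Local Notation V := 'rV[R]_(n1.+2 + n2.+2).

Let cov := flat_cover_prod G1 G2.

(* The kernel of [theta] is the direction along which the two monodromies
   close up simultaneously; all fields below only depend on [theta]. *)
Definition theta (v : V) : R :=
  N2%:R * lsubmx v ord0 ord_max - N1%:R * rsubmx v ord0 ord_max.

Definition theta_col : 'cV[R]_(n1.+2 + n2.+2) :=
  col_mx (N2%:R *: delta_mx ord_max ord0) (- N1%:R *: delta_mx ord_max ord0).

Lemma theta_colE v : (v *m theta_col) ord0 ord0 = theta v.
Proof.
rewrite -{1}[v]hsubmxK mul_row_col -!scalemxAr -!colE /theta !mxE.
by rewrite mulNr.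
Qed.

Definition rotated (c v : V) : V :=
  row_mx (lsubmx c *m Q1 (l1%:~R * theta v)) (rsubmx c *m Q2 (l2%:~R * theta v)).

Lemma theta_rotated c v : theta (rotated c v) = theta c.
Proof.
by rewrite /theta row_mxKl row_mxKr (opg_last Q1L) (opg_last Q2L).
Qed.

Lemma rotated_along c d x (h : R) : theta d = 0 ->
  rotated c (h *: rotated d x + x) = rotated c x.
Proof.
move=> d0; suff E : theta (h *: rotated d x + x) = theta x by rewrite /rotated E.
transitivity (h * theta (rotated d x) + theta x).
  by rewrite -!theta_colE mulmxDl -scalemxAl mxE [X in X + _]mxE.
by rewrite theta_rotated d0 mulr0 add0r.
Qed.

Lemma smooth_rotated c j : smooth_on setT (fun v => rotated c v ord0 j).
Proof.
move=> k.
have Ct : class_C k setT theta.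
  apply: (@eq_class_C _ _ _ _ _ (fun v : V =>
     N2%:R * v ord0 (lshift _ ord_max) - N1%:R * v ord0 (rshift _ ord_max))) => [v|].
    by rewrite /theta !mxE.
  by apply: class_CB; (apply: class_CM; [exact: class_C_cst|exact: class_C_coord]).
have Clt (l : int) : class_C k setT (fun v => l%:~R * theta v).
  by apply: class_CM => //; exact: class_C_cst.
case: (fintype.splitP j) => i ji.
  have -> : j = lshift _ i by exact/val_inj.
  apply: (@eq_class_C _ _ _ _ _ (fun v =>
    \sum_m lsubmx c ord0 m * Q1 (l1%:~R * theta v) m i)) => [v|].
    by rewrite row_mxEl mxE.
  apply: class_C_sum => m _; apply: class_CM; first exact: class_C_cst.
  exact: (opg_smooth Q1L).
have -> : j = rshift _ i by exact/val_inj.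
apply: (@eq_class_C _ _ _ _ _ (fun v =>
  \sum_m rsubmx c ord0 m * Q2 (l2%:~R * theta v) m i)) => [v|].
  by rewrite row_mxEr mxE.
apply: class_C_sum => m _; apply: class_CM; first exact: class_C_cst.
exact: (opg_smooth Q2L).
Qed.

Lemma equivariant_rotated c : equivariant (prod_maps G1 G2) (rotated c).
Proof.
move=> g L v x [g1 [g2 [[e1 [w1 [z1 [E1 ->]]]] [e2 [w2 [z2 [E2 ->]]]] gE]]] gL.
pose LL1 : 'M[R]_n1.+2 := map_mx intr L1; pose LL2 : 'M[R]_n2.+2 := map_mx intr L2.
have -> : L = block_mx (LL1 ^+ e1) 0 0 (LL2 ^+ e2).
  apply: (@affine_linear_part _ _ _ v (row_mx (map_mx intr w1) (map_mx intr w2))).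
  rewrite -gL gE; apply/funext => y.
  rewrite -{3}[y]hsubmxK mul_row_block !mulmx0 addr0 add0r.
  by rewrite add_row_mx.
have th : theta (g x) = theta x +
    (N2%:Z * w1 ord0 ord_max - N1%:Z * w2 ord0 ord_max)%:~R.
  rewrite /theta gE row_mxKl row_mxKr /torus_map [X in _ * X - _]mxE.
  rewrite [X in _ - _ * X]mxE (LR_exp_last L1_last) (LR_exp_last L2_last).
  by rewrite ![map_mx _ _ _ _]mxE rmorphB/= !rmorphM/=; ring.
(* By [bezout1] the parameter grows by the base shift of [w1] modulo [N1], which by [E1] is [e1]
   modulo [N1]; the integer given to [opg_int] collects the multiples of [N1]. *)
have q1 : Q1 (l1%:~R * theta (g x)) = Q1 (l1%:~R * theta x) * LL1 ^+ e1.
  rewrite th mulrDr (opgD Q1L) -intrM; congr (_ * _).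
  rewrite -(opg_int e1 (b1 * w1 ord0 ord_max - z1 - l1 * w2 ord0 ord_max) Q1L L1_order).
  congr (Q1 _%:~R); rewrite E1 mulrBr mulrA bezout1; ring.
have q2 : Q2 (l2%:~R * theta (g x)) = Q2 (l2%:~R * theta x) * LL2 ^+ e2.
  rewrite th mulrDr (opgD Q2L) -intrM; congr (_ * _).
  rewrite -(opg_int e2 (l2 * w1 ord0 ord_max - z2 - b2 * w2 ord0 ord_max) Q2L L2_order).
  congr (Q2 _%:~R); rewrite E2 mulrBr [l2 * (N1%:Z * _)]mulrA bezout2; ring.
rewrite /rotated q1 q2 mul_row_block !mulmx0 addr0 add0r.
by rewrite -!mulmxA.
Qed.

Lemma product_commuting_fields : exists2 k, (n1 + n2 + 3 <= k)%N &
  has_commuting_fields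
    (prod_manifold (mapping_torus (R := R) N1_gt0 L1_last L1_order)
       (mapping_torus (R := R) N2_gt0 L2_last L2_order)) k.
Proof.
(* A single linear form has rank at most 1, which leaves a kernel of dimension at least
   [n1 + n2 + 4 - 1]. *)
exists (\rank (kermx theta_col)).
  by rewrite mxrank_ker; have := rank_leq_col theta_col; lia.
pose c i := row i (row_base (kermx theta_col)).
have c0 i : theta (c i) = 0.
  rewrite -theta_colE; suff -> : c i *m theta_col = 0 by rewrite mxE.
  apply/sub_kermxP; apply: submx_trans (row_sub i _) _.
  by rewrite eq_row_base.
exists (fun i => pushforward cov (rotated (c i))); split.
- move=> i; apply: vector_field_pushforward; first exact: equivariant_rotated.
  exact: smooth_rotated.
- move=> i j; apply: fields_commute_pushforward.
  + exact: equivariant_rotated.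
  + exact: equivariant_rotated.
  + exact: smooth_rotated.
  + exact: smooth_rotated.
  + by move=> x h; exact: rotated_along.
  + by move=> x h; exact: rotated_along.
move=> q; have [x <-] := cover_surj cov q.
apply: independent_pushforward => [i|]; first exact: equivariant_rotated.
(* At [x] the fields are the constant ones multiplied by [B]; the opposite rotations [B'] show that
   [B] is invertible, so independence is kept. *)
pose B := block_mx (Q1 (l1%:~R * theta x)) 0 0 (Q2 (l2%:~R * theta x)).
pose B' := block_mx (Q1 (- (l1%:~R * theta x))) 0 0 (Q2 (- (l2%:~R * theta x))).
have BB : B *m B' = 1%:M.
  rewrite /B /B' mulmx_block !mulmx0 !mul0mx !addr0 !add0r.
  by rewrite [_ *m _](opg_unit _ Q1L) [_ *m _](opg_unit _ Q2L) -scalar_mx_block.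
have freeB : row_free B by rewrite row_free_unit; case: (mulmx1_unit BB).
rewrite (_ : \matrix_i _ = row_base (kermx theta_col) *m B).
  by rewrite /row_free mxrankMfree// -/(row_free _) row_base_free.
apply/row_matrixP => i; rewrite rowK row_mul.
rewrite -[in RHS](hsubmxK (row i _)) mul_row_block !mulmx0 addr0 add0r.
by [].
Qed.

End ProductRank.

(** * Monodromies of orders 2 and 3 *)

Section Instances.
Context {R : realType}.

(** For [c = cos w], the equation [cos (3 w) = 1] reads [(c - 1) (2 c + 1)^2 = 0], and [sin w > 0]
    excludes [c = 1]. *)
Lemma cos_2pi3 : cos (2 * pi / 3) = - 2^-1 :> R.
Proof.
set w : R := 2 * pi / 3; have pi0 := pi_gt0 R.
have w3 : w + w + w = pi *+ 2 by rewrite mulr2n /w; field.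
have sw : 0 < sin w by apply: sin_gt0_pi; apply/andP; split; rewrite /w; lra.
have := congr1 cos w3; rewrite cos2pi !cosD sinD.
have := cos2Dsin2 w; set c := cos w; set s := sin w in sw * => cs E.
have s2 : s * s = 1 - c * c by rewrite -cs; ring.
have {}E : (c - 1) * (2 * c + 1) ^+ 2 = 0.
  have -> : (c - 1) * (2 * c + 1) ^+ 2 =
      (c * c * c - (1 - c * c) * c - 2 * c * (1 - c * c)) - 1 by ring.
  by rewrite -s2 -[X in _ - X]E; ring.
move: E => /eqP; rewrite mulf_eq0 expf_eq0 /= => /orP[/eqP c1|/eqP E]; last lra.
have c1' : c = 1 by lra.
have : s * s = 0 by have := cs; rewrite c1' => ?; lra.
by move=> /eqP; rewrite mulf_eq0 orbb gt_eqF.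
Qed.

Lemma is_derive_cos_sin (ab : R * R) (t : R) :
  is_derive t 1 (fun t => ab.1 * cos t + ab.2 * sin t)
    (ab.2 * cos t + - ab.1 * sin t).
Proof.
have := is_deriveD (is_deriveZ ab.1 (is_derive_cos t)) (is_deriveZ ab.2 (is_derive_sin t)).
by move=> /is_derive_eq; apply; rewrite /GRing.scale/=; ring.
Qed.

Lemma class_C_cos_sin m k (q : 'rV[R]_m -> R) (a b : R) : class_C k setT q ->
  class_C k setT (fun x => a * cos (q x) + b * sin (q x)).
Proof.
move=> Cq.
exact: (@class_C_comp1 _ _ _ _ (fun (ab : R * R) t => ab.1 * cos t + ab.2 * sin t)
  (fun ab => (ab.2, - ab.1)) is_derive_cos_sin (a, b) q Cq).
Qed.

(** [E] projects onto the base direction and [J] is a complex structure on the image of [1 - E], so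
    the family is [exp (t w J)] there and the identity on the base; the group law is the addition
    formulas. *)
Lemma rotation_group n (L : 'M[int]_n.+2) (J : 'M[R]_n.+2) (w : R) :
  let E := delta_mx ord_max ord_max in
  E * J = 0 -> J * E = 0 -> J * J = E - 1 ->
  E + cos w *: (1 - E) + sin w *: J = map_mx intr L ->
  one_parameter_group L
    (fun t => E + cos (t * w) *: (1 - E) + sin (t * w) *: J).
Proof.
move=> E EJ JE JJ QL; set F := 1 - E.
have EE : E * E = E by rewrite -[LHS]/(E *m E) /E mul_delta_mx.
have EF : E * F = 0 by rewrite mulrBr mulr1 EE subrr.
have FE : F * E = 0 by rewrite mulrBl mul1r EE subrr.
have FF : F * F = F by rewrite {1}/F mulrBl EF mul1r subr0.
have FJ : F * J = J by rewrite mulrBl mul1r EJ subr0.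
have JF : J * F = J by rewrite mulrBr mulr1 JE subr0.
have {}JJ : J * J = - F by rewrite JJ opprB.
have lastE (y : 'rV[R]_n.+2) : (y *m E) ord0 ord_max = y ord0 ord_max.
  rewrite mxE (bigD1 ord_max)//= big1 => [|i /negbTE ni]; rewrite mxE ?ni ?mulr0//.
  by rewrite !eqxx mulr1 addr0.
have lastF (y : 'rV[R]_n.+2) : (y *m F) ord0 ord_max = 0.
  by rewrite mulmxBr mulmx1 mxE [X in _ + X]mxE lastE subrr.
have lastJ (y : 'rV[R]_n.+2) : (y *m J) ord0 ord_max = 0.
  by rewrite -JF -[J * F]/(J *m F) mulmxA lastF.
split=> [|s t||t x|m k q i j Cq].
- by rewrite mul0r cos0 sin0 scale1r scale0r addr0 subrKC.
- rewrite mulrDl cosD sinD !mulrDl !mulrDr -!scalerAl -!scalerAr.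
  rewrite EE EF FE FF FJ JF EJ JE JJ !scaler0.
  by apply/matrixP => i j; rewrite !mxE; ring.
- by rewrite mul1r.
- have D (u v v' : 'rV[R]_n.+2) a b : (u + a *: v + b *: v') ord0 ord_max =
      u ord0 ord_max + a * v ord0 ord_max + b * v' ord0 ord_max by rewrite !mxE.
  by rewrite !mulmxDr -!scalemxAr D lastE lastF lastJ !mulr0 !addr0.
- apply: (@eq_class_C _ _ _ _ _ (fun x => E i j +
    (F i j * cos (q x * w) + J i j * sin (q x * w)))) => [x|].
    by rewrite !mxE; ring.
  apply: class_CD; first exact: class_C_cst.
  apply: (@class_C_cos_sin _ _ (fun x => q x * w)).
  by apply: class_CM => //; exact: class_C_cst.
Qed.

Definition mx3 (A : pzRingType) (s : seq (seq A)) : 'M[A]_3 :=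
  \matrix_(i, j) nth 0 (nth [::] s i) j.

(** The fibre block has characteristic polynomial [X^2 + X + 1]: its eigenvalues are the primitive
    cube roots of unity. In [monodromy2] the block is [-1], a half turn. *)
Definition monodromy3 : 'M[int]_3 := mx3 [:: [:: 0; -1; 0]; [:: 1; -1; 0]; [:: 0; 0; 1]].
Definition monodromy2 : 'M[int]_3 := mx3 [:: [:: -1; 0; 0]; [:: 0; -1; 0]; [:: 0; 0; 1]].

Lemma mx3M (A : pzRingType) (s t : seq (seq A)) : mx3 s * mx3 t =
  \matrix_(i, j) \sum_(k < 3) nth 0 (nth [::] s i) k * nth 0 (nth [::] t k) j.
Proof. by apply/matrixP => i j; rewrite !mxE; apply: eq_bigr => k _; rewrite !mxE. Qed.

Ltac mx3_tac := apply/matrixP; case=> -[|[|[|//]]] ?; case=> -[|[|[|//]]] ?;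
  rewrite !mxE ?big_ord_recl ?big_ord0 /=.

Lemma monodromy3_sq : monodromy3 ^+ 2 = mx3 [:: [:: -1; 1; 0]; [:: -1; 0; 0]; [:: 0; 0; 1]].
Proof. by rewrite expr2 mx3M; mx3_tac. Qed.

Lemma monodromy3_order : monodromy3 ^+ 3 = 1.
Proof. by rewrite exprSr monodromy3_sq mx3M; mx3_tac. Qed.

Lemma monodromy2_order : monodromy2 ^+ 2 = 1.
Proof. by rewrite expr2 mx3M; mx3_tac. Qed.

Lemma row_mulmx3 (A : comPzRingType) (w : 'rV[A]_3) (M : 'M[A]_3) j :
  (w *m M) ord0 j = w ord0 ord0 * M ord0 j + w ord0 1 * M 1 j + w ord0 ord_max * M ord_max j.
Proof.
rewrite mxE !big_ord_recl big_ord0 addr0 addrA.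
by congr (_ + _ * _ + _ * _); congr (_ _ _); exact/val_inj.
Qed.

Lemma monodromy3_last (w : 'rV_3) : (w *m monodromy3) ord0 ord_max = w ord0 ord_max.
Proof. by rewrite row_mulmx3 !mxE /= !mulr0 !add0r mulr1. Qed.

Lemma monodromy2_last (w : 'rV_3) : (w *m monodromy2) ord0 ord_max = w ord0 ord_max.
Proof. by rewrite row_mulmx3 !mxE /= !mulr0 !add0r mulr1. Qed.

Lemma monodromy3_trace (w : 'rV_3) : w ord0 ord_max = 0 -> \sum_(i < 3) w *m monodromy3 ^+ i = 0.
Proof.
move=> w0; rewrite -mulmx_sumr !big_ord_recl big_ord0 addr0 /= expr0 expr1 monodromy3_sq.
apply/rowP; case=> -[|[|[|//]]] ?; rewrite row_mulmx3 w0 !mxE /=; ring.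
Qed.

Lemma monodromy2_trace (w : 'rV_3) : w ord0 ord_max = 0 -> \sum_(i < 2) w *m monodromy2 ^+ i = 0.
Proof.
move=> w0; rewrite -mulmx_sumr !big_ord_recl big_ord0 addr0 /= expr0 expr1.
apply/rowP; case=> -[|[|[|//]]] ?; rewrite row_mulmx3 w0 !mxE /=; ring.
Qed.

Lemma delta_max3 (A : pzRingType) : delta_mx ord_max ord_max =
  mx3 [:: [:: 0; 0; 0]; [:: 0; 0; 0]; [:: 0; 0; 1]] :> 'M[A]_3.
Proof. by mx3_tac. Qed.

Lemma monodromy3_rotation : exists Q, one_parameter_group (R := R) monodromy3 Q.
Proof.
pose w : R := 2 * pi / 3; have cw : cos w = - 2^-1 := cos_2pi3.
have s2 : sin w * sin w = 3 / 4.
  by have := cos2Dsin2 w; rewrite cw => E; rewrite -expr2; lra.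
have s0 : sin w != 0.
  by apply/eqP => E; move: s2; rewrite E mul0r => ?; lra.
(* Solving [cos w + sin w J = L] on the fibre with [cos w = -1/2] gives [J = (2 L + 1) / (2 sin w)],
   whose square is -1 because [(2 L + 1)^2 = -3]. *)
pose J : 'M[R]_3 := (2 * sin w)^-1 *: mx3 [:: [:: 1; -2; 0]; [:: 2; -1; 0]; [:: 0; 0; 0]].
exists (fun t => delta_mx ord_max ord_max + cos (t * w) *: (1 - delta_mx ord_max ord_max)
  + sin (t * w) *: J).
apply: rotation_group; rewrite delta_max3.
- by rewrite /J -scalerAr mx3M; mx3_tac; ring.
- by rewrite /J -scalerAl mx3M; mx3_tac; ring.
- rewrite /J -scalerAr -scalerAl scalerA mx3M.
  have -> : (2 * sin w)^-1 * (2 * sin w)^-1 = 3^-1.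
    by rewrite -invfM mulrACA s2; congr (_^-1); field.
  by mx3_tac; field.
- by rewrite /J scalerA cw; mx3_tac; field.
Qed.

Lemma monodromy2_rotation : exists Q, one_parameter_group (R := R) monodromy2 Q.
Proof.
(* As [sin pi = 0], any complex structure on the fibre would do; this is a quarter turn. *)
pose J : 'M[R]_3 := mx3 [:: [:: 0; 1; 0]; [:: -1; 0; 0]; [:: 0; 0; 0]].
exists (fun t => delta_mx ord_max ord_max + cos (t * pi) *: (1 - delta_mx ord_max ord_max)
  + sin (t * pi) *: J).
apply: rotation_group; rewrite delta_max3.
- by rewrite /J mx3M; mx3_tac; ring.
- by rewrite /J mx3M; mx3_tac; ring.
- by rewrite /J mx3M; mx3_tac; ring.
- by rewrite cospi sinpi; mx3_tac; ring.
Qed.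

Lemma rank_exists n (M : atlas_space R n) d :
  (forall k, has_commuting_fields M k -> (k <= d)%N) ->
  exists2 r, is_rank M r & (r <= d)%N.
Proof.
move=> Md.
have H0 : exists k, `[< has_commuting_fields M k >].
  exists 0%N; apply/asboolP; exists (fun _ _ _ => 0).
  by split=> [[]//|[]//|p a _ []].
have [r /asboolP Mr rmax] := ex_maxnP H0 (fun k Mk => Md k (asboolW Mk)).
exists r; last exact: Md.
by split=> // k Mk; apply: rmax; exact/asboolP.
Qed.

End Instances.

Theorem mainTheorem1 (R : realType) :
  exists (m n : nat) (M : atlas_space R m) (N : atlas_space R n),
    [/\ closed_manifold M, closed_manifold N &
      exists rM rN rMN : nat,
        [/\ is_rank M rM, is_rank N rN, is_rank (prod_manifold M N) rMN
          & (rM + rN < rMN)%N]].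
Proof.
pose M := mapping_torus (R := R) (isT : 0 < 3)%N monodromy3_last monodromy3_order.
pose N := mapping_torus (R := R) (isT : 0 < 2)%N monodromy2_last monodromy2_order.
have [rM rankM M2] : exists2 r, is_rank M r & (r <= 2)%N.
  by apply: rank_exists => k; exact: mapping_torus_rank monodromy3_trace k.
have [rN rankN N2] : exists2 r, is_rank N r & (r <= 2)%N.
  by apply: rank_exists => k; exact: mapping_torus_rank monodromy2_trace k.
(* The bound by the dimension 6 serves only to make the maximum exist. *)
have [rMN rankMN _] : exists2 r, is_rank (prod_manifold M N) r & (r <= 6)%N.
  by apply: rank_exists => k; exact: (has_commuting_fields_dim (flat_cover_prod _ _)).
exists 3%N, 3%N, M, N; split; try exact: closed_orbit_manifold.
exists rM, rN, rMN; split => //.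
have [Q3 HQ3] := @monodromy3_rotation R; have [Q2 HQ2] := @monodromy2_rotation R.
(* The Bezout data are [2 * 2 = 1 + 3 * 1] and [1 * 3 = -1 + 2 * 2]. With [n1 = n2 = 1] the product
   has at least 5 fields, against at most [2 + 2]. *)
have [k k5 /(rankMN.2) kr] := product_commuting_fields (isT : 0 < 3)%N (isT : 0 < 2)%N
  monodromy3_last monodromy2_last monodromy3_order monodromy2_order HQ3 HQ2
  (l1 := 2) (l2 := 1) (b1 := 1) (b2 := 2)
  erefl erefl.
by rewrite (leq_ltn_trans (leq_add M2 N2))// (leq_trans k5).
Qed.
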